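(* Assume that the residue characteristic of $K$ is different from $2$. Let $V$ be a $K$-analytic annulus of modulus $e$, let $\sigma$ be an automorphism of $V$ of order $2$ that acts on $\pi$ as the multiplication by an element $\zeta$ of $\{\pm1\}$, and assume that $\sigma$ switches the branches of $V$. Then $V$ is either an open or a closed annulus, $\zeta^e=1$, and there exist a unit $u$ of $R$ that is invariant under $\sigma$ and elements $X,Y$ of $\mathcal O^\circ_V(V)$ such that $$\sigma(X)=Y,\qquad \sigma(Y)=X,$$ together with an isomorphism $$\mathcal O^\circ_V(V)\cong\frac{R[[X,Y]]}{(XY-u\pi^e)}$$ whenever $V$ is an open annulus, and $$\mathcal O^\circ_V(V)\cong\frac{R\{X,Y\}}{(XY-u\pi^e)}$$ whenever $V$ is a closed annulus.
   Context: $K$ is a field complete with respect to a nontrivial discrete valuation, $R$ its valuation ring, $\pi$ a uniformizer, $k$ the residue field; $R\{\cdot\}$ denotes convergent power series (coefficients tending to $0$). An open (resp. semi-open, resp. closed) annulus $V$ over $K$ of modulus $e\ge1$ is a $K$-analytic space isomorphic to the one associated with $\mathrm{Spf}(A)$, where $A\cong R[[X,Y]]/(XY-\pi^e)$ (resp. $R\{X\}[[Y]]/(XY-\pi^e)$, resp. $R\{X,Y\}/(XY-\pi^e)$), i.e. the locus $XY=\pi^e$ in $\{|X|<1,|Y|<1\}$ (resp. $\{|X|\le1,|Y|<1\}$, resp. $\{|X|\le1,|Y|\le1\}$); an annulus is any one of these three types, and $A=\mathcal O^\circ_V(V)$ is the ring of analytic functions on $V$ bounded by $1$. The canonical reduction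 of $V$, i.e. the formal spectrum of $A\otimes_Rk$, has two irreducible components, with generic points $(X)$ and $(Y)$. An automorphism $\sigma$ of $V$ is an automorphism of analytic spaces which need not act trivially on $K$: it respects the absolute value of $K$, hence induces an automorphism of $R$ and of $k$, and acts compatibly on $\mathcal O^\circ_V(V)$. It switches the branches of $V$ if its action on the canonical reduction exchanges the points $(X)$ and $(Y)$.
   Formalization: Added hypothesis: if ζ = −1 and e is odd, σ acts trivially on the residue field k. Without it the claim ζ^e = 1 fails: over C((π)), conjugate coefficients, π ↦ −π, X ↦ iY, Y ↦ iX on XY = π. *)

(* Defs.v *)
From HB Require Import structures.
From mathcomp Require Import all_boot all_order all_algebra.
From mathcomp Require Import ring_quotient boolp.

Set Implicit Arguments.
Unset Strict Implicit.
Unset Printing Implicit Defensive.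

Import Order.TTheory GRing.Theory Num.Theory.
Local Open Scope ring_scope.
Local Open Scope quotient_scope.

(** * Discretely valued fields *)

(* A nontrivial discrete valuation, written additively and normalised to have
   value group int.  The value [dval 0] is meaningless: "v x >= n" must be read
   through [val_ge] below. *)
Record discreteValuation (K : fieldType) := DiscreteValuation {
  dval :> K -> int;
  dvalM : forall x y, x != 0 -> y != 0 -> dval (x * y) = dval x + dval y;
  dvalD : forall x y, x != 0 -> y != 0 -> x + y != 0 ->
    Num.min (dval x) (dval y) <= dval (x + y);
  dval_norm : exists2 x, x != 0 & dval x = 1
}.

Section Valuation.
Variables (K : fieldType) (v : discreteValuation K).

Definition val_ge (n : int) (x : K) : bool := (x == 0) || (n <= v x).

Definition complete_valuation : Prop :=
  forall s : nat -> K,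
    (forall n : int, exists N : nat, forall i j : nat,
       (N <= i)%N -> (N <= j)%N -> val_ge n (s i - s j)) ->
  exists l : K,
    forall n : int, exists N : nat, forall i : nat,
      (N <= i)%N -> val_ge n (s i - l).

Lemma dval1 : v 1 = 0.
Proof.
have /= := dvalM v (oner_neq0 K) (oner_neq0 K).
by rewrite mulr1 -{1}[v 1]addr0 => /addrI.
Qed.

Lemma dvalV x : x != 0 -> v x^-1 = - v x.
Proof.
move=> x0; apply/eqP; rewrite -addr_eq0 -dvalM ?invr_eq0 //.
by rewrite mulVf // dval1.
Qed.

Lemma dvalN x : v (- x) = v x.
Proof.
have [->|x0] := eqVneq x 0; first by rewrite oppr0.
have n1 : (-1 : K) != 0 by rewrite oppr_eq0 oner_neq0.
have vN1 : v (-1) = 0.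
  have := dvalM v n1 n1; rewrite mulrNN mulr1 dval1 => /esym/eqP.
  by rewrite -mulr2n mulrn_eq0 => /eqP.
by rewrite -mulN1r dvalM // vN1 add0r.
Qed.

Lemma val_ge0 n : val_ge n 0. Proof. by rewrite /val_ge eqxx. Qed.

Lemma val_geN n x : val_ge n (- x) = val_ge n x.
Proof. by rewrite /val_ge oppr_eq0 dvalN. Qed.

Lemma val_geD n x y : val_ge n x -> val_ge n y -> val_ge n (x + y).
Proof.
have [->|x0] := eqVneq x 0; first by rewrite add0r.
have [->|y0] := eqVneq y 0; first by rewrite addr0.
have [xy0|xy0] := eqVneq (x + y) 0; first by rewrite /val_ge xy0 eqxx.
rewrite /val_ge (negPf x0) (negPf y0) (negPf xy0) /= => hx hy.
by apply: le_trans (dvalD v x0 y0 xy0); rewrite le_min hx hy.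
Qed.

Lemma val_geB n x y : val_ge n x -> val_ge n y -> val_ge n (x - y).
Proof. by move=> hx hy; apply: val_geD => //; rewrite val_geN. Qed.

Lemma val_geM m n x y : val_ge m x -> val_ge n y -> val_ge (m + n) (x * y).
Proof.
have [->|x0] := eqVneq x 0; first by rewrite mul0r !val_ge0.
have [->|y0] := eqVneq y 0; first by rewrite mulr0 !val_ge0.
rewrite /val_ge (negPf x0) (negPf y0) (negPf (mulf_neq0 x0 y0)) /=.
by move=> hx hy; rewrite dvalM // lerD.
Qed.

Lemma val_ge_sum n (I : Type) (r : seq I) (P : pred I) (F : I -> K) :
  (forall i, P i -> val_ge n (F i)) -> val_ge n (\sum_(i <- r | P i) F i).
Proof.
by move=> hF; elim/big_ind: _ => //; [exact: val_ge0 | exact: val_geD].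
Qed.

Definition in_valRing : {pred K} := [pred x | val_ge 0 x].

Lemma in_valRing_subring : subring_closed in_valRing.
Proof.
split=> [|x y|x y]; rewrite !inE.
- by rewrite /val_ge dval1 lexx orbT.
- exact: val_geB.
- by move=> hx hy; rewrite -[0]addr0; apply: val_geM.
Qed.

HB.instance Definition _ :=
  GRing.isSubringClosed.Build K in_valRing in_valRing_subring.

(* The valuation ring. *)
Record valRing := ValRing { vrval :> K; vrvalP : vrval \in in_valRing }.

HB.instance Definition _ := [isSub for vrval].
HB.instance Definition _ := [Choice of valRing by <:].
HB.instance Definition _ := [SubChoice_isSubComNzRing of valRing by <:].

Lemma valRing_ge0 (x : valRing) : val_ge 0 (x : K). Proof. exact: vrvalP. Qed.

Definition valRing_unit : pred valRing :=
  [pred x : valRing | (vrval x != 0) && (v (vrval x) == 0)].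

Lemma valRing_inv_subproof (x : valRing) :
  (if valRing_unit x then (vrval x)^-1 else vrval x) \in in_valRing.
Proof.
case: ifP => [/andP[x0 /eqP vx]|_]; last exact: vrvalP.
by rewrite inE /val_ge dvalV // vx oppr0 lexx orbT.
Qed.

Definition valRing_inv (x : valRing) : valRing :=
  ValRing (valRing_inv_subproof x).

Lemma valRing_mulVr : {in valRing_unit, left_inverse 1 valRing_inv *%R}.
Proof.
move=> x ux; apply: val_inj => /=.
have ux' : valRing_unit x := ux.
by rewrite ux' mulVf //; case/andP: ux'.
Qed.

Lemma valRing_unitP (x y : valRing) : y * x = 1 -> valRing_unit x.
Proof.
move=> /(congr1 vrval) /= yx.
have x0 : vrval x != 0.
  by apply: contraTneq (oner_neq0 K) => h; rewrite -yx h mulr0 eqxx.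
have y0 : vrval y != 0.
  by apply: contraTneq (oner_neq0 K) => h; rewrite -yx h mul0r eqxx.
have := congr1 v yx; rewrite dvalM // dval1 => h.
have hx : 0 <= v (vrval x) by have := valRing_ge0 x; rewrite /val_ge (negPf x0).
have hy : 0 <= v (vrval y) by have := valRing_ge0 y; rewrite /val_ge (negPf y0).
rewrite /valRing_unit /= x0 /=.
by move/eqP: h; rewrite paddr_eq0 // => /andP[].
Qed.

Lemma valRing_inv_out : {in [predC valRing_unit], valRing_inv =1 id}.
Proof.
by move=> x /negbTE ux; apply: val_inj => /=; rewrite [valRing_unit x]ux.
Qed.

HB.instance Definition _ := GRing.ComNzRing_hasMulInverse.Build valRing
  valRing_mulVr valRing_unitP valRing_inv_out.

Definition uniformizer (p : valRing) : Prop :=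
  (vrval p != 0) /\ v (vrval p) = 1.

(* The maximal ideal and the residue field. *)
Definition in_maxIdeal (x : valRing) : bool := val_ge 1 (vrval x).

Lemma in_maxIdeal_closed : idealr_closed in_maxIdeal.
Proof.
split=> [||a x y]; rewrite ?[_ \in in_maxIdeal]unfold_in /in_maxIdeal.
- exact: val_ge0.
- by rewrite /val_ge oner_eq0 dval1.
- move=> hx hy; apply: val_geD => //=.
  by rewrite -[1]add0r; apply: val_geM => //; apply: valRing_ge0.
Qed.

HB.instance Definition _ :=
  isIdealr.Build valRing in_maxIdeal in_maxIdeal_closed.

Definition maxIdeal : idealr valRing := in_maxIdeal.

Definition residueField := {ideal_quot maxIdeal}.
HB.instance Definition _ := GRing.ComNzRing.on residueField.

Definition residue (x : valRing) : residueField := \pi_residueField x.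

(* Automorphisms of K respecting its absolute value, and the automorphism of
   the valuation ring which they induce. *)
Record isometricAut := IsometricAut {
  isom_fun :> {rmorphism K -> K};
  isom_bij : bijective isom_fun;
  isom_val : forall x, v (isom_fun x) = v x
}.

Lemma isomR_subproof (tau : isometricAut) (r : valRing) :
  tau (vrval r) \in in_valRing.
Proof.
by have := vrvalP r; rewrite !inE /val_ge isom_val fmorph_eq0.
Qed.

Definition isomR (tau : isometricAut) (r : valRing) : valRing :=
  ValRing (isomR_subproof tau r).

End Valuation.

(** * Formal power series in one variable *)

Record fps (R : Type) := Fps { fpsf : nat -> R }.

HB.instance Definition _ (R : Type) := [isNew for @fpsf R].
HB.instance Definition _ (R : choiceType) := [Choice of fps R by <:].

Section FpsRing.
Variable R : comNzRingType.
Implicit Types s t : fps R.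

Lemma fpsP s t : fpsf s =1 fpsf t -> s = t.
Proof. by case: s t => [s] [t] /= /funext ->. Qed.

Definition fps_zero : fps R := Fps (fun=> 0).
Definition fps_opp s : fps R := Fps (fun n => - fpsf s n).
Definition fps_add s t : fps R := Fps (fun n => fpsf s n + fpsf t n).
Definition fpsC (c : R) : fps R := Fps (fun n => if n == 0%N then c else 0).
Definition fps_mul s t : fps R :=
  Fps (fun n => \sum_(i < n.+1) fpsf s i * fpsf t (n - i)%N).

(* The variable. *)
Definition fpsX : fps R := Fps (fun n => (n == 1%N)%:R).

Lemma fps_addA : associative fps_add.
Proof. by move=> s t u; apply: fpsP => n /=; rewrite addrA. Qed.
Lemma fps_addC : commutative fps_add.
Proof. by move=> s t; apply: fpsP => n /=; rewrite addrC. Qed.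
Lemma fps_add0 : left_id fps_zero fps_add.
Proof. by move=> s; apply: fpsP => n /=; rewrite add0r. Qed.
Lemma fps_addN : left_inverse fps_zero fps_opp fps_add.
Proof. by move=> s; apply: fpsP => n /=; rewrite addNr. Qed.

HB.instance Definition _ :=
  GRing.isZmodule.Build (fps R) fps_addA fps_addC fps_add0 fps_addN.

Definition fps_trunc (N : nat) s : {poly R} := \poly_(i < N) fpsf s i.

Lemma fps_mul_trunc N s t n : (n < N)%N ->
  fpsf (fps_mul s t) n = (fps_trunc N s * fps_trunc N t)`_n.
Proof.
move=> nN; rewrite coefM; apply: eq_bigr => i _ /=.
rewrite !coef_poly (leq_ltn_trans (leq_subr i n) nN).
by rewrite (leq_trans (ltn_ord i) nN).
Qed.

Lemma fps_mulC : commutative fps_mul.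
Proof.
by move=> s t; apply: fpsP => n; rewrite !(@fps_mul_trunc n.+1) // mulrC.
Qed.

Lemma fps_mulA : associative fps_mul.
Proof.
move=> s t u; apply: fpsP => n.
transitivity ((fps_trunc n.+1 s * fps_trunc n.+1 t * fps_trunc n.+1 u)`_n).
  rewrite -mulrA coefM /=; apply: eq_bigr => i _.
  rewrite coef_poly ltn_ord; congr (_ * _).
  by apply: (@fps_mul_trunc n.+1); rewrite ltnS leq_subr.
rewrite coefM /=; apply: eq_bigr => i _.
rewrite coef_poly ltnS leq_subr; congr (_ * _).
by symmetry; apply: (@fps_mul_trunc n.+1).
Qed.

Lemma fps_mul1 : left_id (fpsC 1) fps_mul.
Proof.
move=> s; apply: fpsP => n /=; rewrite big_ord_recl /= mul1r subn0.
by rewrite big1 ?addr0 // => i _; rewrite mul0r.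
Qed.

Lemma fps_mulDl : left_distributive fps_mul fps_add.
Proof.
move=> s t u; apply: fpsP => n /=; rewrite -big_split /=.
by apply: eq_bigr => i _; rewrite mulrDl.
Qed.

Lemma fps_oner_neq0 : fpsC 1 != 0.
Proof.
by apply/eqP => /(congr1 (fun s => fpsf s 0%N)) /= /eqP; rewrite oner_eq0.
Qed.

HB.instance Definition _ := GRing.Zmodule_isComNzRing.Build (fps R)
  fps_mulA fps_mulC fps_mul1 fps_mulDl fps_oner_neq0.

End FpsRing.

(** * Rings of convergent power series *)

Section Convergent.
Variables (K : fieldType) (v : discreteValuation K).
Local Notation R := (valRing v).

(* Coefficients tending to 0 in the valuation topology.  In [fps (fps R)] the
   coefficient of X^i Y^j is [fpsf (fpsf s j) i]: the outer variable is Y. *)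
Definition tends0 (s : fps R) : Prop :=
  forall n : int, exists N : nat, forall i : nat,
    (N <= i)%N -> val_ge v n (vrval (fpsf s i)).

Definition tends0_2 (s : fps (fps R)) : Prop :=
  forall n : int, exists N : nat, forall i j : nat,
    (N <= i + j)%N -> val_ge v n (vrval (fpsf (fpsf s j) i)).

Lemma vrval_sum (I : Type) (r : seq I) (P : pred I) (F : I -> R) :
  vrval (\sum_(i <- r | P i) F i) = \sum_(i <- r | P i) vrval (F i).
Proof. exact: (raddf_sum (\val : R -> K)). Qed.

Lemma fpsf_sum (S : comNzRingType) (I : Type) (r : seq I) (P : pred I)
    (F : I -> fps S) n :
  fpsf (\sum_(i <- r | P i) F i) n = \sum_(i <- r | P i) fpsf (F i) n.
Proof. by elim/big_rec2: _ => // i x y _ <-. Qed.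

Lemma val_ge_mull n (x y : R) :
  val_ge v n (vrval x) -> val_ge v n (vrval (x * y)).
Proof. by move=> hx; rewrite -[n]addr0; apply: val_geM => //; exact: vrvalP. Qed.

Lemma val_ge_mulr n (x y : R) :
  val_ge v n (vrval y) -> val_ge v n (vrval (x * y)).
Proof. by rewrite mulrC; apply: val_ge_mull. Qed.

Definition in_cvps : {pred fps R} := [pred s | `[< tends0 s >]].
Definition in_cvps2 : {pred fps (fps R)} := [pred s | `[< tends0_2 s >]].

Lemma in_cvpsP (s : fps R) : reflect (tends0 s) (s \in in_cvps).
Proof. exact: asboolP. Qed.

Lemma in_cvps2P (s : fps (fps R)) : reflect (tends0_2 s) (s \in in_cvps2).
Proof. exact: asboolP. Qed.

Lemma in_cvps_subring : subring_closed in_cvps.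
Proof.
split.
- apply/in_cvpsP => n; exists 1%N => -[|i] //= _; exact: val_ge0.
- move=> s t /in_cvpsP hs /in_cvpsP ht; apply/in_cvpsP => n.
  have [N hN] := hs n; have [M hM] := ht n.
  exists (maxn N M) => i; rewrite geq_max => /andP[Ni Mi].
  by apply: val_geB; [apply: hN | apply: hM].
- move=> s t /in_cvpsP hs /in_cvpsP ht; apply/in_cvpsP => n.
  have [N hN] := hs n; have [M hM] := ht n.
  exists (N + M)%N => k hk /=; rewrite vrval_sum; apply: val_ge_sum => a _.
  have [Na|aN] := leqP N a; first exact/val_ge_mull/hN.
  apply/val_ge_mulr/hM; rewrite leq_subRL; last by rewrite -ltnS ltn_ord.
  by apply: leq_trans hk; rewrite leq_add2r ltnW.
Qed.

Lemma in_cvps2_subring : subring_closed in_cvps2.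
Proof.
split.
- apply/in_cvps2P => n; exists 1%N => -[|i] [|j] //= _; exact: val_ge0.
- move=> s t /in_cvps2P hs /in_cvps2P ht; apply/in_cvps2P => n.
  have [N hN] := hs n; have [M hM] := ht n.
  exists (maxn N M) => i j; rewrite geq_max => /andP[Nij Mij].
  by apply: val_geB; [apply: hN | apply: hM].
- move=> s t /in_cvps2P hs /in_cvps2P ht; apply/in_cvps2P => n.
  have [N hN] := hs n; have [M hM] := ht n.
  exists (N + M)%N => i j hk /=; rewrite fpsf_sum vrval_sum.
  apply: val_ge_sum => a _; rewrite /= vrval_sum; apply: val_ge_sum => b _.
  have [Na|aN] := leqP N (b + a); first exact/val_ge_mull/hN.
  apply/val_ge_mulr/hM.
  have ai : (a <= j)%N by rewrite -ltnS ltn_ord.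
  have bi : (b <= i)%N by rewrite -ltnS ltn_ord.
  rewrite -(leq_add2l (b + a)) addnACA !subnKC //.
  by apply: leq_trans hk; rewrite leq_add2r ltnW.
Qed.

HB.instance Definition _ :=
  GRing.isSubringClosed.Build (fps R) in_cvps in_cvps_subring.
HB.instance Definition _ :=
  GRing.isSubringClosed.Build (fps (fps R)) in_cvps2 in_cvps2_subring.

(* R{X} and R{X,Y}. *)
Record cvps := Cvps { cvpsf :> fps R; cvpsP : cvpsf \in in_cvps }.
HB.instance Definition _ := [isSub for cvpsf].
HB.instance Definition _ := [Choice of cvps by <:].
HB.instance Definition _ := [SubChoice_isSubComNzRing of cvps by <:].

Record cvps2 := Cvps2 { cvps2f :> fps (fps R); cvps2P : cvps2f \in in_cvps2 }.
HB.instance Definition _ := [isSub for cvps2f].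
HB.instance Definition _ := [Choice of cvps2 by <:].
HB.instance Definition _ := [SubChoice_isSubComNzRing of cvps2 by <:].

Lemma cvpsC_subproof (c : R) : fpsC c \in in_cvps.
Proof. by apply/in_cvpsP => n; exists 1%N => -[|i] //= _; exact: val_ge0. Qed.
Definition cvpsC (c : R) : cvps := Cvps (cvpsC_subproof c).

Lemma cvpsX_subproof : fpsX R \in in_cvps.
Proof.
by apply/in_cvpsP => n; exists 2%N => -[|[|i]] //= _; exact: val_ge0.
Qed.
Definition cvpsX : cvps := Cvps cvpsX_subproof.

Lemma cvps2C_subproof (c : R) : fpsC (fpsC c) \in in_cvps2.
Proof.
by apply/in_cvps2P => n; exists 1%N => -[|i] [|j] //= _; exact: val_ge0.
Qed.
Definition cvps2C (c : R) : cvps2 := Cvps2 (cvps2C_subproof c).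

Lemma cvps2X_subproof : fpsC (fpsX R) \in in_cvps2.
Proof.
by apply/in_cvps2P => n; exists 2%N => -[|[|i]] [|j] //= _; exact: val_ge0.
Qed.
Definition cvps2X : cvps2 := Cvps2 cvps2X_subproof.

Lemma cvps2Y_subproof : fpsX (fps R) \in in_cvps2.
Proof.
apply/in_cvps2P => n; exists 2%N => -[|[|i]] [|[|j]] //= _; exact: val_ge0.
Qed.
Definition cvps2Y : cvps2 := Cvps2 cvps2Y_subproof.

End Convergent.

(** * Annuli *)

(* An annulus V is represented by the R-algebra A of its analytic functions
   bounded by 1; V is recovered as the generic fibre of Spf A. *)

Inductive annulus_kind := Open | SemiOpen | Closed.

Section Annuli.
Variables (K : fieldType) (v : discreteValuation K).
Local Notation R := (valRing v).

(* R[[X,Y]], R{X}[[Y]] and R{X,Y}. *)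
Definition bidiskRing (t : annulus_kind) : comNzRingType :=
  match t with
  | Open => fps (fps R)
  | SemiOpen => fps (cvps v)
  | Closed => cvps2 v
  end.

Definition bidiskC (t : annulus_kind) : R -> bidiskRing t :=
  match t with
  | Open => fun c => fpsC (fpsC c)
  | SemiOpen => fun c => fpsC (cvpsC c)
  | Closed => fun c => cvps2C c
  end.

Definition bidiskX (t : annulus_kind) : bidiskRing t :=
  match t with
  | Open => fpsC (fpsX R)
  | SemiOpen => fpsC (cvpsX v)
  | Closed => cvps2X v
  end.

Definition bidiskY (t : annulus_kind) : bidiskRing t :=
  match t with
  | Open => fpsX (fps R)
  | SemiOpen => fpsX (cvps v)
  | Closed => cvps2Y v
  end.

(* An isomorphism of R-algebras from the quotient of [bidiskRing t] by the ideal
   generated by XY - c onto A, given as a surjection with that ideal as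
   kernel. *)
Record annulusIso (t : annulus_kind) (c : R) (A : comAlgType R) :=
  AnnulusIso {
    aiso :> {rmorphism bidiskRing t -> A};
    aisoC : forall r : R, aiso (bidiskC t r) = r%:A;
    aiso_surj : forall a : A, exists s, aiso s = a;
    aiso_ker : forall s, aiso s = 0 <->
      exists g, s = g * (bidiskX t * bidiskY t - bidiskC t c)
  }.

Definition coordX t c A (phi : annulusIso t c A) : A := phi (bidiskX t).
Definition coordY t c A (phi : annulusIso t c A) : A := phi (bidiskY t).

(* An automorphism of V need not be K-linear.  Continuity for the topology of
   Spf A is automatic: the largest ideal of definition of A is its Jacobson
   radical (open and semi-open case) or the radical of the ideal generated by a
   uniformizer (closed case), and is thus preserved by any such ring
   automorphism. *)
Record annulusAut (A : comAlgType R) := AnnulusAut {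
  aut_base : isometricAut v;
  aut_fun :> {rmorphism A -> A};
  aut_bij : bijective aut_fun;
  aut_compat : forall r : R, aut_fun r%:A = (isomR aut_base r)%:A
}.

Definition aut_order2 (A : comAlgType R) (sigma : annulusAut A) : Prop :=
  [/\ involutive (aut_base sigma), involutive sigma & ~ (sigma =1 id)].

(* With a nontrivial action on the residue field, sigma may switch the branches
   and act on a uniformizer pi by -1 even if the modulus is odd: over the complex
   Laurent series in pi, let sigma conjugate the coefficients and map pi to -pi,
   X to iY and Y to iX; it has order 2 on the annulus XY = pi. *)
Definition acts_trivially_on_residue (A : comAlgType R)
    (sigma : annulusAut A) : Prop :=
  forall r : R, residue (isomR (aut_base sigma) r) = residue r.

(* The ideal (x) of the canonical reduction A/(pi), as an ideal of A. *)
Definition reduction_ideal (A : comAlgType R) (pi : R) (x a : A) : Prop :=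
  exists b c : A, a = b * x + c * pi%:A.

(* The points (X) and (Y) of the canonical reduction are exchanged by pulling
   back ideals along sigma. *)
Definition switches_branches (pi : R) t c (A : comAlgType R)
    (phi : annulusIso t c A) (sigma : annulusAut A) : Prop :=
  (forall a, reduction_ideal pi (coordX phi) (sigma a) <->
             reduction_ideal pi (coordY phi) a) /\
  (forall a, reduction_ideal pi (coordY phi) (sigma a) <->
             reduction_ideal pi (coordX phi) a).

End Annuli.

(* Main.v *)
(* Let x, y be the coordinates of V, xy = pi^e.  Modulo the prime (y, pi) the
   element sigma(y) is nonzero, since y is not in (x, pi); as
   sigma(x) sigma(y) = +-xy, dividing out pi step by step gives sigma(x) in yA,
   and symmetrically sigma(y) in xA, so sigma(x) = w y with w a unit and
   w = zeta^e sigma(w).  A unit of A is a constant r modulo the ideal J, where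
   J = (pi, x, y) for an open annulus and J = (pi) for a closed one.  If
   zeta^e = -1 this would give 2 r = 0 in the residue field; so w is invariant,
   r is invariant in the residue field, and u = (r + tau(r)) / 2 is an invariant
   unit of R with w / u in 1 + J.  Let s be the square root of w / u in 1 + J;
   uniqueness makes it invariant, and X = x / s, Y = sigma(X) = u s y satisfy
   XY = u pi^e.  They are again coordinates because the substitution X -> X / S,
   Y -> u S Y, with S in 1 + J lifting s, is a bijective endomorphism of
   R[[X,Y]] or R{X,Y}: up to the scaling of Y by u it is the identity modulo J.

   On a semi-open annulus 1 - sigma(x) is invertible modulo pi, as
   sigma(x) is in (y, pi) and Y is topologically nilpotent, whereas 1 - x is not
   even invertible modulo (y, pi), where it becomes a nonconstant polynomial. *)
Require Import Defs.
From HB Require Import structures.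
From mathcomp Require Import all_boot all_order all_algebra.
From mathcomp Require Import ring_quotient boolp zify ring.
Import Order.TTheory GRing.Theory Num.Theory.
Local Open Scope ring_scope.

Set Implicit Arguments.
Unset Strict Implicit.
Unset Printing Implicit Defensive.

(** * The valuation ring *)

Section ValuationRing.
Variables (K : fieldType) (v : discreteValuation K).
Local Notation R := (valRing v).
Implicit Types (r s : R) (m n : nat).

(** The n-th power of the maximal ideal. Indexing by natural numbers makes truncated subtraction
    usable for weights: a nonpositive exponent gives the whole ring. *)
Definition mpow n r : bool := val_ge v n%:Z (vrval r).

Lemma mpow00 n : mpow n 0. Proof. exact: val_ge0. Qed.
Lemma mpow0 r : mpow 0 r. Proof. exact: valRing_ge0. Qed.
Lemma mpowN n r : mpow n (- r) = mpow n r. Proof. exact: val_geN. Qed.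
Lemma mpowD n r s : mpow n r -> mpow n s -> mpow n (r + s).
Proof. exact: val_geD. Qed.
Lemma mpowB n r s : mpow n r -> mpow n s -> mpow n (r - s).
Proof. exact: val_geB. Qed.
Lemma mpowM m n r s : mpow m r -> mpow n s -> mpow (m + n) (r * s).
Proof. by rewrite /mpow PoszD; apply: val_geM. Qed.
Lemma mpowW m n r : (m <= n)%N -> mpow n r -> mpow m r.
Proof.
move=> mn /orP[h|h]; rewrite /mpow /val_ge ?h //.
by apply/orP; right; apply: le_trans h; rewrite lez_nat.
Qed.
Lemma mpowMl n r s : mpow n r -> mpow n (r * s).
Proof. by move=> h; rewrite -[n]addn0; apply: mpowM (mpow0 _). Qed.
Lemma mpowMr n r s : mpow n s -> mpow n (r * s).
Proof. by rewrite mulrC; apply: mpowMl. Qed.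
Lemma mpow_sum n (I : Type) (l : seq I) (P : pred I) (F : I -> R) :
  (forall i, P i -> mpow n (F i)) -> mpow n (\sum_(i <- l | P i) F i).
Proof. by move=> h; elim/big_ind: _ => //; [exact: mpow00 | exact: mpowD]. Qed.
Lemma mpow_eq0 r : (forall n, mpow n r) -> r = 0.
Proof.
move=> h; apply/val_inj/eqP => /=; apply/negPn/negP => r0.
have := h `|v (vrval r)|.+1; rewrite /mpow /val_ge (negPf r0) /=; lia.
Qed.

Lemma unit_mpow1E r : (r \is a GRing.unit) = ~~ mpow 1 r.
Proof.
have hr : val_ge v 0 (vrval r) := valRing_ge0 r.
rewrite -[LHS]/(valRing_unit r) /valRing_unit /mpow /= negb_or.
by move: hr; rewrite /val_ge; case: eqVneq => //= _ h; lia.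
Qed.

(** The maximal ideal is prime because a product is a unit exactly when both factors are. *)
Lemma mpow1M r s : mpow 1 (r * s) = mpow 1 r || mpow 1 s.
Proof. by apply: negb_inj; rewrite negb_or -!unit_mpow1E unitrM. Qed.

Lemma mpow11 : ~~ mpow 1 (1 : R).
Proof. by rewrite -unit_mpow1E unitr1. Qed.

Section Uniformizer.
Variables (pi : R) (hpi : uniformizer pi).

Lemma mpow_pi : mpow 1 pi.
Proof. by case: hpi => h0 h1; rewrite /mpow /val_ge h1 lexx orbT. Qed.

Lemma mpow_piX n : mpow n (pi ^+ n).
Proof.
elim: n => [|n IH]; first exact: mpow0.
by rewrite exprS -[n.+1]add1n; apply: mpowM mpow_pi IH.
Qed.

Lemma mpow_piM n r : mpow n.+1 (pi * r) = mpow n r.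
Proof.
case: hpi => h0 h1; rewrite /mpow /val_ge /= mulf_eq0 (negPf h0) /=.
have [//|r0] := eqVneq (vrval r) 0.
rewrite dvalM // h1 /=; lia.
Qed.

Lemma mpow1P r : mpow 1 r -> exists s, r = pi * s.
Proof.
case: hpi => h0 h1 h.
have hs : vrval r / vrval pi \in in_valRing v.
  have [r0|r0] := eqVneq (vrval r) 0.
    by rewrite inE r0 mul0r val_ge0.
  move: h; rewrite inE /mpow /val_ge (negPf r0) /=.
  rewrite mulf_eq0 (negPf r0) invr_eq0 (negPf h0) /= dvalM ?invr_eq0 //.
  by rewrite dvalV // h1; lia.
by exists (ValRing hs); apply: val_inj; rewrite /= mulrC divfK.
Qed.

Lemma pi_regular r : pi * r = 0 -> r = 0.
Proof. by move=> h; apply: mpow_eq0 => n; rewrite -mpow_piM h mpow00. Qed.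

End Uniformizer.

Hypothesis hcomplete : complete_valuation v.

(** The offset [c] will be the weight [eps * (k + l)] of a coefficient in the filtration [Fil], by
    which its convergence lags. *)
Lemma valRing_cauchy (c : nat) (r : nat -> R) :
  (forall n, mpow (n - c) (r n.+1 - r n)) ->
  exists s, forall n, mpow (n - c) (s - r n).
Proof.
move=> hr.
have hd n d : mpow (n - c) (r (n + d)%N - r n).
  elim: d => [|d IH]; first by rewrite addn0 subrr mpow00.
  have -> : r (n + d.+1)%N - r n
    = (r (n + d).+1 - r (n + d)%N) + (r (n + d)%N - r n).
    by rewrite addnS; ring.
  by apply: mpowD => //; apply: mpowW (hr _); rewrite leq_sub2r ?leq_addr.
have [|l hl] := hcomplete (s := fun n => vrval (r n)).
  (* From the index |n| + c on, all terms agree with that one to precision n, by [hd]. *)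
  move=> n; exists (`|n| + c)%N => i j hi hj.
  have ni : (n <= Posz (`|n| + c - c))%R by lia.
  have main k : (`|n| + c <= k)%N ->
      val_ge v n (vrval (r k) - vrval (r (`|n| + c)%N)).
    move=> hk; have := hd (`|n| + c)%N (k - (`|n| + c))%N; rewrite subnKC //.
    rewrite /mpow /val_ge /= => /orP[->//|h]; apply/orP; right.
    exact: le_trans h.
  have -> : vrval (r i) - vrval (r j) =
    (vrval (r i) - vrval (r (`|n| + c)%N))
    - (vrval (r j) - vrval (r (`|n| + c)%N)) by ring.
  by apply: val_geB; apply: main.
have hR : l \in in_valRing v.
  have [N hN] := hl 0; rewrite inE.
  have -> : l = vrval (r N) - (vrval (r N) - l) by ring.
  by apply: val_geB; [exact: valRing_ge0 | apply: hN].
exists (ValRing hR) => n.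
have [N hN] := hl (n - c)%N.
have -> : ValRing hR - r n =
    (r (n + N)%N - r n) - (r (n + N)%N - ValRing hR) by ring.
by apply: mpowB => //; apply: (hN (n + N)%N); rewrite leq_addl.
Qed.

End ValuationRing.

(** * Double power series *)

Section DoubleSeries.
Variable R : comNzRingType.
Local Notation PS := (fps (fps R)).
Implicit Types (F G : PS) (k l : nat).

Definition cf F k l : R := fpsf (fpsf F l) k.

Lemma cfP F G : (forall k l, cf F k l = cf G k l) -> F = G.
Proof. by move=> h; apply: fpsP => l; apply: fpsP => k; apply: h. Qed.

Lemma cf0 k l : cf 0 k l = 0. Proof. by []. Qed.
Lemma cfD F G k l : cf (F + G) k l = cf F k l + cf G k l. Proof. by []. Qed.
Lemma cfN F k l : cf (- F) k l = - cf F k l. Proof. by []. Qed.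
Lemma cfB F G k l : cf (F - G) k l = cf F k l - cf G k l. Proof. by []. Qed.

Lemma cf_sum (I : Type) (r : seq I) (P : pred I) (F : I -> PS) k l :
  cf (\sum_(i <- r | P i) F i) k l = \sum_(i <- r | P i) cf (F i) k l.
Proof. by rewrite /cf !fpsf_sum. Qed.

Lemma cfM F G k l : cf (F * G) k l =
  \sum_(b < l.+1) \sum_(a < k.+1) cf F a b * cf G (k - a)%N (l - b)%N.
Proof. by rewrite /cf /= fpsf_sum. Qed.

Lemma cfM00 F G : cf (F * G) 0 0 = cf F 0 0 * cf G 0 0.
Proof. by rewrite cfM !big_ord1. Qed.

Definition psC (c : R) : PS := fpsC (fpsC c).
Definition psX : PS := fpsC (fpsX R).
Definition psY : PS := fpsX (fps R).

Lemma cfC c k l : cf (psC c) k l = if (k == 0) && (l == 0) then c else 0.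
Proof. by rewrite /cf /=; case: l => [|l] /=; rewrite ?andbF ?andbT. Qed.

Lemma cfCM c F k l : cf (psC c * F) k l = c * cf F k l.
Proof.
rewrite cfM !big_ord_recl /= !subn0 cfC /= [X in _ * _ + X]big1 => [|i _].
  by rewrite addr0 big1 ?addr0 // => i _; rewrite big1 // => j _;
    rewrite cfC andbF mul0r.
by rewrite cfC mul0r.
Qed.

Lemma cfXM F k l : cf (psX * F) k l = if k is k'.+1 then cf F k' l else 0.
Proof.
rewrite cfM big_ord_recl /= subn0 [X in _ + X]big1 => [|i _]; last first.
  by rewrite big1 // => j _; rewrite /cf /= mul0r.
rewrite addr0; case: k => [|k]; first by rewrite big_ord1 /cf /= mul0r.
rewrite !big_ord_recl big1 => [|i _]; last by rewrite /cf /= mul0r.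
by rewrite addr0 /cf /= mul0r add0r mul1r subn1.
Qed.

Lemma cfYM F k l : cf (psY * F) k l = if l is l'.+1 then cf F k l' else 0.
Proof.
rewrite cfM; case: l => [|l].
  by rewrite big_ord1 big1 // => i _; rewrite /cf /= mul0r.
rewrite big_ord_recl [X in X + _]big1 => [|i _]; last by rewrite /cf /= mul0r.
rewrite add0r big_ord_recl [X in _ + X]big1 => [|i _]; last first.
  by rewrite big1 // => j _; rewrite /cf /= mul0r.
rewrite addr0 big_ord_recl [X in _ + X]big1 => [|i _]; last first.
  by rewrite /cf /= mul0r.
by rewrite addr0 /cf /= mul1r subn0 subn1.
Qed.

Lemma cfXn i F k l :
  cf (psX ^+ i * F) k l = if (i <= k)%N then cf F (k - i)%N l else 0.
Proof.
elim: i k => [|i IH] [|k]; rewrite ?expr0 ?mul1r ?subn0 // exprS -mulrA cfXM //.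
Qed.

Lemma cfYn j F k l :
  cf (psY ^+ j * F) k l = if (j <= l)%N then cf F k (l - j)%N else 0.
Proof.
elim: j l => [|j IH] [|l]; rewrite ?expr0 ?mul1r ?subn0 // exprS -mulrA cfYM //.
Qed.

Lemma cf_monomial c i j k l :
  cf (psC c * psX ^+ i * psY ^+ j) k l = if (k == i) && (l == j) then c else 0.
Proof.
have -> : psC c * psX ^+ i * psY ^+ j = psY ^+ j * (psX ^+ i * psC c) by ring.
rewrite cfYn cfXn cfC; do !case: ifP => //; lia.
Qed.

(** The truncation keeps a square of exponents, which contains every monomial of total degree below
    N. *)
Definition psTrunc N F : PS :=
  \sum_(j < N) \sum_(i < N) psC (cf F i j) * psX ^+ i * psY ^+ j.

Lemma cf_trunc N F k l :
  cf (psTrunc N F) k l = if (k < N)%N && (l < N)%N then cf F k l else 0.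
Proof.
rewrite cf_sum; under eq_bigr => j _ do
  (rewrite cf_sum; under eq_bigr => i _ do rewrite cf_monomial).
case: ifP => [/andP[kN lN]|hN].
  rewrite (bigD1 (Ordinal lN)) //= (bigD1 (Ordinal kN)) //= !eqxx /=.
  rewrite big1 ?addr0 => [|i ik]; last first.
    by rewrite ?eqxx ?andbT eq_sym (negPf (_ : val i != k)).
  rewrite big1 ?addr0 // => j jl; rewrite big1 // => i _.
  by rewrite [l == j]eq_sym (negPf (_ : val j != l)) ?andbF.
rewrite big1 // => j _; rewrite big1 // => i _.
case: ifP => // /andP[/eqP hk /eqP hl].
by rewrite hk hl !ltn_ord in hN.
Qed.

(** Quotients of the division by X and by Y; the remainder is the part free of that variable. *)
Definition psShiftX F : PS := Fps (fun l => Fps (fun k => cf F k.+1 l)).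
Definition psShiftY F : PS := Fps (fun l => Fps (fun k => cf F k l.+1)).

Lemma ps_splitX F k l :
  cf (F - psX * psShiftX F) k l = if k is 0 then cf F 0 l else 0.
Proof. by rewrite cfB cfXM; case: k => [|k]; rewrite ?subr0 ?subrr. Qed.

Lemma ps_splitY F k l :
  cf (F - psY * psShiftY F) k l = if l is 0 then cf F k 0 else 0.
Proof. by rewrite cfB cfYM; case: l => [|l]; rewrite ?subr0 ?subrr. Qed.

(** Membership in the n-th power of the ideal (X, Y). *)
Definition ps_ord n F := forall k l, (k + l < n)%N -> cf F k l = 0.

Lemma ps_ord0 F : ps_ord 0 F. Proof. by []. Qed.
Lemma ps_ord_sum n (I : Type) (r : seq I) (P : pred I) (F : I -> PS) :
  (forall i, P i -> ps_ord n (F i)) -> ps_ord n (\sum_(i <- r | P i) F i).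
Proof. by move=> h k l kl; rewrite cf_sum big1 // => i /h; apply. Qed.
Lemma ps_ordW m n F : (m <= n)%N -> ps_ord n F -> ps_ord m F.
Proof. by move=> mn h k l kl; apply: h; apply: leq_trans mn. Qed.
Lemma ps_ordM m n F G : ps_ord m F -> ps_ord n G -> ps_ord (m + n) (F * G).
Proof.
move=> hF hG k l kl; rewrite cfM big1 // => b _; rewrite big1 // => a _.
have [h|h] := ltnP (a + b) m; first by rewrite hF ?mul0r.
rewrite hG ?mulr0 //; have := ltn_ord a; have := ltn_ord b; lia.
Qed.
Lemma ps_ordX n F : ps_ord 1 F -> ps_ord n (F ^+ n).
Proof.
move=> h; elim: n => [|n IH]; first exact: ps_ord0.
by rewrite exprS; apply: ps_ordM h IH.
Qed.

End DoubleSeries.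
Arguments psX {R}.
Arguments psY {R}.

(** * Substitution in formal power series *)

Section Substitution.
Variables (S R : comNzRingType) (h : {rmorphism S -> fps (fps R)}).
Variables (V : fps (fps R)) (hV : ps_ord 1 V).

Local Notation ev p := ((map_poly h p).[V]).

Lemma ps_ord_eval N (p : {poly S}) :
  (forall i, (i < N)%N -> p`_i = 0) -> ps_ord N (ev p).
Proof.
move=> hp; rewrite horner_coef.
apply: ps_ord_sum => i _; rewrite coef_map /=.
have [iN|Ni] := ltnP i N; first by rewrite hp // rmorph0 mul0r.
by apply: (ps_ordW Ni); apply: (@ps_ordM _ 0 i); [exact: ps_ord0 | exact: ps_ordX].
Qed.

(* The sum of the h(f_j) V^j converges for the (X,Y)-adic topology: only its
   terms with j <= k + l contribute to the coefficient of X^k Y^l. *)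
Definition subst_fps (_ : ps_ord 1 V) (f : fps S) : fps (fps R) :=
  Fps (fun l => Fps (fun k => cf (ev (fps_trunc (k + l).+1 f)) k l)).
Local Notation sub := (subst_fps hV).

(** A truncation of length N determines the coefficients of total degree below N, since V^i has
    order at least i. The ring laws for [sub] are thereby checked on evaluations of polynomials. *)
Lemma subst_fpsE N f : ps_ord N (sub f - ev (fps_trunc N f)).
Proof.
move=> k l kl; rewrite cfB [cf (sub f) k l]/cf /= -cfB.
rewrite -hornerN -hornerD -rmorphN -rmorphD.
apply: (@ps_ord_eval (k + l).+1) => [i ikl|//].
rewrite coefD coefN !coef_poly ikl (leq_trans _ kl) ?subrr //.
Qed.

Lemma subst_fps_cf N f k l : (k + l < N)%N ->
  cf (sub f) k l = cf (ev (fps_trunc N f)) k l.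
Proof. by move=> /subst_fpsE h1; apply/subr0_eq; rewrite -cfB h1. Qed.

Lemma subst_fpsB : zmod_morphism sub.
Proof.
move=> f g; apply: cfP => k l; rewrite cfB !(@subst_fps_cf (k + l).+1) //.
rewrite -cfB -hornerN -hornerD -rmorphN -rmorphD; congr (cf (ev _) k l).
by apply/polyP => i; rewrite coefD coefN !coef_poly; case: ifP => //; rewrite subrr.
Qed.

Lemma subst_fpsC c : sub (fpsC c) = h c.
Proof.
apply: cfP => k l; rewrite (@subst_fps_cf (k + l).+1) //.
have -> : fps_trunc (k + l).+1 (fpsC c) = c%:P.
  by apply/polyP => i; rewrite coefC coef_poly; case: i => //= i; rewrite if_same.
by rewrite map_polyC hornerC.
Qed.

Lemma subst_fpsX : sub (fpsX S) = V.
Proof.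
apply: cfP => k l; rewrite (@subst_fps_cf (k + l).+2) //.
have -> : fps_trunc (k + l).+2 (fpsX S) = 'X.
  by apply/polyP => i; rewrite coefX coef_poly /=; case: i => [|[|i]] //=;
     rewrite if_same.
by rewrite map_polyX hornerX.
Qed.

Lemma subst_fpsM : monoid_morphism sub.
Proof.
split; first by rewrite -[1]/(fpsC 1) subst_fpsC rmorph1.
move=> f g; apply: cfP => k l.
set N := (k + l).+1; rewrite (@subst_fps_cf N) //.
have -> : cf (sub f * sub g) k l
    = cf (ev (fps_trunc N f) * ev (fps_trunc N g)) k l.
  rewrite !cfM; apply: eq_bigr => b _; apply: eq_bigr => a _.
  by rewrite !(@subst_fps_cf N) // /N; have := ltn_ord a; have := ltn_ord b; lia.
rewrite -hornerM -rmorphM; apply/subr0_eq.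
rewrite -cfB -hornerN -hornerD -rmorphN -rmorphD.
(* The truncation of [f * g] and the product of the truncations share their coefficients below N. *)
apply: (@ps_ord_eval N) => [i iN|]; last exact: leqnn.
rewrite coefD coefN coef_poly iN -(fps_mul_trunc f g iN).
by rewrite -[f * g]/(fps_mul f g) subrr.
Qed.

HB.instance Definition _ :=
  GRing.isZmodMorphism.Build (fps S) (fps (fps R)) sub subst_fpsB.
HB.instance Definition _ :=
  GRing.isMonoidMorphism.Build (fps S) (fps (fps R)) sub subst_fpsM.

End Substitution.

Section Substitution2.
Variable R : comNzRingType.
Local Notation PS := (fps (fps R)).

Lemma psCB : zmod_morphism (@psC R).
Proof.
move=> a b; apply: cfP => k l; rewrite cfB !cfC.
by case: ifP => //; rewrite subrr.
Qed.

Lemma psCM : monoid_morphism (@psC R).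
Proof.
split=> [|a b]; first by [].
by apply: cfP => k l; rewrite cfCM !cfC; case: ifP => //; rewrite mulr0.
Qed.

HB.instance Definition _ := GRing.isZmodMorphism.Build R PS (@psC R) psCB.
HB.instance Definition _ := GRing.isMonoidMorphism.Build R PS (@psC R) psCM.

(** The factor V^j makes up for the order j that the coefficient of degree j may lack. *)
Lemma subst_fps_ord (S : comNzRingType) (h : {rmorphism S -> PS}) (V : PS)
    (hV : ps_ord 1 V) N (f : fps S) :
  (forall j, ps_ord (N - j) (h (fpsf f j))) -> ps_ord N (subst_fps h hV f).
Proof.
move=> hf k l kl; rewrite (subst_fps_cf _ _ _ kl) horner_coef.
move: k l kl; apply: ps_ord_sum => i _; rewrite coef_map coef_poly /=.
case: ifP => [iN|_]; last by rewrite rmorph0 mul0r.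
apply: (@ps_ordW _ N (N - i + i)); first by rewrite subnK // ltnW.
by apply: ps_ordM => //; apply: ps_ordX.
Qed.

(** Two nested substitutions: the inner one sends X to [U] on R[[X]], the outer one sends Y to [V]
    and acts on coefficients by the inner one. Preservation of [ps_ord] is the continuity by which
    [T] is determined on polynomials. *)
Lemma subst_fps2_exists (U V : PS) : ps_ord 1 U -> ps_ord 1 V ->
  exists T : {rmorphism PS -> PS},
    [/\ forall c, T (psC c) = psC c, T (psX) = U, T (psY) = V
      & forall N F, ps_ord N F -> ps_ord N (T F)].
Proof.
move=> hU hV; pose T1 : {rmorphism fps R -> PS} := subst_fps (@psC R) hU.
exists (subst_fps T1 hV); split=> [c|||N F hF].
- transitivity (T1 (fpsC c)); exact: subst_fpsC.
- transitivity (T1 (fpsX R)); [exact: subst_fpsC | exact: subst_fpsX].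
- exact: subst_fpsX.
- apply: subst_fps_ord => j; apply: subst_fps_ord => i.
  move=> k l kl; rewrite cfC; case: ifP => // _; apply: hF.
  by lia.
Qed.

Lemma subst_term (c u : R) (P Q : PS) i j :
  psC c * (psX * P) ^+ i * (psC u * psY * Q) ^+ j =
  psC (c * u ^+ j) * psX ^+ i * psY ^+ j * (P ^+ i * Q ^+ j).
Proof.
have gen (A : comNzRingType) (d x p w y q : A) :
    d * (x * p) ^+ i * (w * y * q) ^+ j
  = d * w ^+ j * x ^+ i * y ^+ j * (p ^+ i * q ^+ j).
  by rewrite !exprMn; ring.
have -> : psC (c * u ^+ j) = psC c * psC u ^+ j by rewrite rmorphM rmorphXn.
exact: (gen (fps (fps R))).
Qed.

Lemma subst_termB (c u : R) (P Q : PS) i j :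
  psC c * (psX * P) ^+ i * (psC u * psY * Q) ^+ j
    - psC (c * u ^+ j) * psX ^+ i * psY ^+ j =
  psC (c * u ^+ j) * psX ^+ i * psY ^+ j * (P ^+ i * Q ^+ j - 1).
Proof. by rewrite mulrBr mulr1; congr (_ - _); exact: subst_term. Qed.

Section SubstitutionTheory.
Variables (U V : PS) (T : {rmorphism PS -> PS}).
Hypotheses (TC : forall c, T (psC c) = psC c) (TX : T (psX) = U).
Hypotheses (TY : T (psY) = V) (Tord : forall N F, ps_ord N F -> ps_ord N (T F)).

Lemma subst_trunc N F : T (psTrunc N F) =
  \sum_(j < N) \sum_(i < N) psC (cf F i j) * U ^+ i * V ^+ j.
Proof.
rewrite rmorph_sum; apply: eq_bigr => j _; rewrite rmorph_sum.
by apply: eq_bigr => i _; rewrite !rmorphM !rmorphXn TC TX TY.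
Qed.

Lemma subst_cf N F k l : (k + l < N)%N ->
  cf (T F) k l = cf (T (psTrunc N F)) k l.
Proof.
move=> kl; apply/subr0_eq; rewrite -cfB -rmorphB.
apply: (Tord _ kl) => a b ab; rewrite cfB cf_trunc.
by rewrite !(leq_ltn_trans _ ab) ?subrr // ?leq_addr ?leq_addl.
Qed.

End SubstitutionTheory.
End Substitution2.

(** * Filtrations of the double power series *)

Section Filtration.
Variables (K : fieldType) (v : discreteValuation K).
Local Notation R := (valRing v).
Local Notation PS := (fps (fps R)).
Variable eps : bool.
Implicit Types (F G : PS) (n : nat).

(* The powers of the ideal (pi, X, Y) if eps = true, of (pi) if eps = false. *)
Definition Fil n F := forall k l, mpow (n - eps * (k + l)) (cf F k l).

Lemma Fil0 F : Fil 0 F.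
Proof. by move=> k l; rewrite sub0n; apply: mpow0. Qed.
Lemma Fil00 n : Fil n 0. Proof. by move=> k l; apply: mpow00. Qed.
Lemma Fil_eq n F G : F = G -> Fil n G -> Fil n F. Proof. by move->. Qed.
Lemma FilD n F G : Fil n F -> Fil n G -> Fil n (F + G).
Proof. by move=> hF hG k l; rewrite cfD mpowD. Qed.
Lemma FilN n F : Fil n F -> Fil n (- F).
Proof. by move=> hF k l; rewrite cfN mpowN. Qed.
Lemma FilB n F G : Fil n F -> Fil n G -> Fil n (F - G).
Proof. by move=> hF hG; apply: FilD => //; apply: FilN. Qed.
Lemma Fil_sum n (I : Type) (r : seq I) (P : pred I) (F : I -> PS) :
  (forall i, P i -> Fil n (F i)) -> Fil n (\sum_(i <- r | P i) F i).
Proof. by move=> h; elim/big_ind: _ => //; [exact: Fil00 | exact: FilD]. Qed.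
Lemma FilW m n F : (m <= n)%N -> Fil n F -> Fil m F.
Proof. by move=> mn hF k l; apply: mpowW (hF k l); rewrite leq_sub2r. Qed.
Lemma FilM m n F G : Fil m F -> Fil n G -> Fil (m + n) (F * G).
Proof.
move=> hF hG k l; rewrite cfM; apply: mpow_sum => b _; apply: mpow_sum => a _.
apply: mpowW (mpowM (hF a b) (hG _ _)).
have := ltn_ord a; have := ltn_ord b.
by case: (eps); rewrite ?mul1n ?mul0n ?subn0 //; lia.
Qed.
Lemma FilMl n F G : Fil n F -> Fil n (F * G).
Proof. by move=> h; rewrite -[n]addn0; apply: FilM (Fil0 _). Qed.
Lemma FilMr n F G : Fil n G -> Fil n (F * G).
Proof. by rewrite mulrC; apply: FilMl. Qed.
Lemma Fil_eq0 F : (forall n, Fil n F) -> F = 0.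
Proof.
move=> h; apply: cfP => k l; apply: mpow_eq0 => n.
by have := h (n + eps * (k + l))%N k l; rewrite addnK.
Qed.

Lemma Fil_unipM F G : Fil 1 (F - 1) -> Fil 1 (G - 1) -> Fil 1 (F * G - 1).
Proof.
move=> hF hG; have -> : F * G - 1 = (F - 1) * G + (G - 1) by ring.
by apply: FilD => //; apply: FilMl.
Qed.
Lemma Fil_unipX F i : Fil 1 (F - 1) -> Fil 1 (F ^+ i - 1).
Proof.
move=> hF; elim: i => [|i IH]; first by rewrite expr0 subrr; apply: Fil00.
by rewrite exprS; apply: Fil_unipM.
Qed.

Lemma Fil_monomial n F i j c : Fil n F ->
  Fil n (psC (cf F i j * c) * psX ^+ i * psY ^+ j).
Proof.
move=> hF k l; rewrite cf_monomial; case: ifP => [/andP[/eqP-> /eqP->]|_].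
  exact/mpowMl/hF.
exact: mpow00.
Qed.

(* Vacuous if eps = true, since the weight n - (k + l) is truncated; the
   coefficients tend to 0 if eps = false. *)
Definition conv F := forall n, exists N, forall k l, (N <= k + l)%N ->
  mpow (n - eps * (k + l)) (cf F k l).

(** Closedness of [conv] in the topology of [Fil]; it will place limits in the bidisk ring. *)
Lemma conv_approx F : (forall n, exists2 G, conv G & Fil n (F - G)) -> conv F.
Proof.
move=> h n; have [G hG hFG] := h n; have [N hN] := hG n; exists N => k l kl.
by rewrite -[F](subrK G) cfD; apply: mpowD; [apply: hFG | apply: hN].
Qed.

(** Density of the polynomials among the convergent series. *)
Lemma conv_trunc F n : conv F -> exists N, Fil n (F - psTrunc N F).
Proof.
move=> /(_ n)[N hN]; exists N => k l; rewrite cfB cf_trunc.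
case: ifP => [_|hkl]; first by rewrite subrr mpow00.
rewrite subr0; apply: hN; lia.
Qed.

Lemma conv_shiftX F : conv F -> conv (psShiftX F).
Proof.
move=> hF n; have [N hN] := hF n.+1; exists N => k l kl.
apply: mpowW (hN k.+1 l _); last lia.
by case: (eps); rewrite ?mul1n ?mul0n; lia.
Qed.

Lemma conv_shiftY F : conv F -> conv (psShiftY F).
Proof.
move=> hF n; have [N hN] := hF n.+1; exists N => k l kl.
apply: mpowW (hN k l.+1 _); last lia.
by case: (eps); rewrite ?mul1n ?mul0n; lia.
Qed.

Lemma conv_div pi F G : uniformizer pi -> conv F -> F = psC pi * G -> conv G.
Proof.
move=> hpi hF FG n; have [N hN] := hF n.+1; exists N => k l kl.
have := hN k l kl; rewrite FG cfCM => h.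
have [ne|en] := leqP (eps * (k + l)) n; first by rewrite -(mpow_piM hpi) -subSn.
by rewrite (eqP (ltnW en)) mpow0.
Qed.

(** * Substitutions congruent to a scaling of Y *)

Section Contraction.
Variables (P Q : PS) (u : R) (hP : Fil 1 (P - 1)) (hQ : Fil 1 (Q - 1)).
Variable T : {rmorphism PS -> PS}.
Hypotheses (TC : forall c, T (psC c) = psC c) (TX : T (psX) = psX * P).
Hypotheses (TY : T (psY) = psC u * psY * Q).
Hypothesis Tord : forall N F, ps_ord N F -> ps_ord N (T F).

Lemma Fil_subst n F : Fil n F -> Fil n (T F).
Proof.
move=> hF k l; rewrite (subst_cf Tord F (leqnn (k + l).+1)).
rewrite (subst_trunc TC TX TY); move: (k + l).+1 => N.
suff h : Fil n (\sum_(j < N) \sum_(i < N)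
   psC (cf F i j) * (psX * P) ^+ i * (psC u * psY * Q) ^+ j) by apply: h.
apply: Fil_sum => j _; apply: Fil_sum => i _.
by apply: Fil_eq (subst_term _ _ _ _ _ _) _; apply/FilMl/Fil_monomial.
Qed.

(** Here [G] is F(X, uY). Monomial by monomial, the error carries the factor P^i Q^j - 1, which
    gains one step of the filtration. *)
Lemma Fil_subst_scale n F G : Fil n F ->
  (forall k l, cf G k l = cf F k l * u ^+ l) -> Fil n.+1 (T F - G).
Proof.
move=> hF hG k l; set N := (k + l).+1.
have -> : cf (T F - G) k l = cf (T (psTrunc N F) - psTrunc N G) k l.
  rewrite !cfB (@subst_cf _ _ Tord N) // cf_trunc.
  by rewrite !ltnS leq_addr leq_addl.
rewrite (subst_trunc TC TX TY) -sumrB; clearbody N.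
set S := \sum_(i < N) _; suff h : Fil n.+1 S by apply: h.
apply: Fil_sum => j _; rewrite -sumrB; apply: Fil_sum => i _.
rewrite hG; apply: Fil_eq (subst_termB _ _ _ _ _ _) _.
rewrite -[n.+1]addn1; apply: FilM; first exact: Fil_monomial.
by apply: Fil_unipM; apply: Fil_unipX.
Qed.

End Contraction.
End Filtration.

(** * Power series over the residue field *)

Section ResidualSeries.
Variables (K : fieldType) (v : discreteValuation K).
Local Notation R := (valRing v).
Implicit Types f g : fps R.

(** All terms of the convolution but one vanish in the residue field. The pivot will be a pair of
    lowest, or of highest, nonvanishing coefficients. *)
Lemma mpow1_pivot f g a b :
  (forall i, (i <= a + b)%N -> i != a ->
     mpow 1 (fpsf f i) || mpow 1 (fpsf g (a + b - i)%N)) ->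
  mpow 1 (fpsf (f * g) (a + b)%N) = mpow 1 (fpsf f a) || mpow 1 (fpsf g b).
Proof.
move=> h; have ha : (a < (a + b).+1)%N by rewrite ltnS leq_addr.
have -> : fpsf (f * g) (a + b)%N
    = \sum_(i < (a + b).+1) fpsf f i * fpsf g (a + b - i)%N by [].
rewrite (bigD1 (Ordinal ha)) //= addKn -mpow1M.
set S := \sum_(i < _ | _) _.
have hS : mpow 1 S.
  apply: mpow_sum => i; rewrite -val_eqE /= => ia.
  by have := h i; rewrite -ltnS ltn_ord => /(_ isT ia); rewrite -mpow1M.
by apply/idP/idP => h1; [rewrite -(addrK S (_ * _)); apply: mpowB | apply: mpowD].
Qed.

(** Power series over the residue field form a domain: the first nonvanishing coefficients of the
    factors give a nonvanishing coefficient of the product. *)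
Lemma mpow1_fps_prime f g : (forall n, mpow 1 (fpsf (f * g) n)) ->
  ~ (forall n, mpow 1 (fpsf f n)) -> forall n, mpow 1 (fpsf g n).
Proof.
move=> hfg /existsNP[a0 /negP ha0] b0; apply/negPn/negP => hb0.
have [a ha amin] := find_ex_minn (ex_intro (fun n => ~~ mpow 1 (fpsf f n)) _ ha0).
have [b hb bmin] := find_ex_minn (ex_intro (fun n => ~~ mpow 1 (fpsf g n)) _ hb0).
have := hfg (a + b)%N; rewrite mpow1_pivot ?(negPf ha) ?(negPf hb) // => i iab ia.
apply/orP; have [lt|ge] := ltnP i a.
  by left; apply/negPn/negP => /amin; rewrite leqNgt lt.
right; apply/negPn/negP => /bmin.
by move: ia ge iab; rewrite neq_ltn; lia.
Qed.

(** The first hypothesis makes both reductions polynomials over the residue field. Their product is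
    a nonzero constant, so comparing leading coefficients forces degree 0. *)
Lemma mpow1_fps_unit f g N :
  (forall n, (N <= n)%N -> mpow 1 (fpsf f n) && mpow 1 (fpsf g n)) ->
  ~~ mpow 1 (fpsf (f * g) 0%N) ->
  (forall n, (0 < n)%N -> mpow 1 (fpsf (f * g) n)) ->
  forall n, (0 < n)%N -> mpow 1 (fpsf f n).
Proof.
move=> hN h0 hfg n0 n0_gt0; apply/negPn/negP => hn0.
(* A nonvanishing coefficient of [g], so that its reduction has a degree. *)
have hg0 : ~~ mpow 1 (fpsf g 0%N).
  move: h0; have -> : fpsf (f * g) 0%N = fpsf f 0%N * fpsf g 0%N.
    by rewrite /= big_ord1.
  by rewrite mpow1M negb_or => /andP[].
have fb i : ~~ mpow 1 (fpsf f i) -> (i <= N)%N.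
  by apply: contraR; rewrite -ltnNge => /ltnW/hN/andP[].
have gb i : ~~ mpow 1 (fpsf g i) -> (i <= N)%N.
  by apply: contraR; rewrite -ltnNge => /ltnW/hN/andP[].
case: (@ex_maxnP _ _ (ex_intro (fun n => ~~ mpow 1 (fpsf f n)) _ hn0) fb)
  => a ha amax.
case: (@ex_maxnP _ _ (ex_intro (fun n => ~~ mpow 1 (fpsf g n)) _ hg0) gb)
  => b hb bmax.
have a0 : (0 < a)%N by apply: leq_trans n0_gt0 (amax _ hn0).
have := hfg (a + b)%N; rewrite ltn_addr // => /(_ isT).
rewrite mpow1_pivot ?(negPf ha) ?(negPf hb) // => i iab ia.
apply/orP; have [lt|ge] := ltnP a i.
  by left; apply/negPn/negP => /amax; rewrite leqNgt lt.
right; apply/negPn/negP => /bmax.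
by move: ia ge iab; rewrite neq_ltn; lia.
Qed.

Implicit Types F G : fps (fps R).

(** The values at Y = 0 and, for [psRowY], at X = 0, as series in the remaining variable. *)
Definition psRowX F : fps R := fpsf F 0%N.
Definition psRowY F : fps R := Fps (fun l => cf F 0 l).

Lemma psRowXM F G : psRowX (F * G) = psRowX F * psRowX G.
Proof. by rewrite /psRowX /= big_ord1. Qed.

Lemma psRowYM F G : psRowY (F * G) = psRowY F * psRowY G.
Proof.
apply: fpsP => l; rewrite /= cfM; apply: eq_bigr => b _.
by rewrite big_ord1.
Qed.

End ResidualSeries.

(** By induction on k up to e, f lies in (y, p^k); for k = e the power p^e = x y is itself a
    multiple of y. For the step, write f = a y + b p^k. To have b in (y, p) it is enough that g b
    lies there, g being regular modulo (y, p), and for this that p divides g b x. *)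
Lemma dvd_of_dvd_mul (A : comNzRingType) (p x y f g : A) e :
  x * y = p ^+ e -> (forall a, p * a = 0 -> a = 0) ->
  (forall h c, h * x = p * c -> exists b d, h = b * y + d * p) ->
  (forall b c d, g * b = c * y + d * p -> exists c d, b = c * y + d * p) ->
  (exists s, g * f = s * y) -> exists w, f = w * y.
Proof.
move=> xy preg xreg greg [s gf].
have pXreg n a : p ^+ n * a = 0 -> a = 0.
  by elim: n a => [|n IH] a; rewrite ?mul1r // exprS -mulrA => /preg/IH.
have main k : (k <= e)%N -> exists a b, f = a * y + b * p ^+ k.
  elim: k => [|k IH] ke; first by exists 0, f; rewrite mul0r add0r mulr1.
  have [a [b fE]] := IH (ltnW ke).
  have [m em] : exists m, e = (k + m.+1)%N by exists (e - k.+1)%N; lia.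
  have [b1 [d1 gb]] : exists b1 d1, g * b = b1 * y + d1 * p.
    apply: (xreg _ (p ^+ m * (s - g * a))).
    apply/subr0_eq/(pXreg k).
    (* Multiplied by x, this identity has x y = p^e as a factor on the right; cancelling p^k still
       leaves a factor p. *)
    have e1 : p ^+ k * (g * b) = (s - g * a) * y.
      by rewrite mulrBl -gf fE; ring.
    have -> : p ^+ k * (g * b * x - p * (p ^+ m * (s - g * a)))
       = (p ^+ k * (g * b)) * x - p ^+ (k + m.+1) * (s - g * a).
      by rewrite exprD exprS; ring.
    by rewrite e1 -em -xy; ring.
  have [c2 [d2 bE]] := greg _ _ _ gb.
  by exists (a + c2 * p ^+ k), d2; rewrite fE bE exprS; ring.
have [a [b ->]] := main e (leqnn e).
by exists (a + b * x); rewrite -xy; ring.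
Qed.

Lemma rmorphism_exists (B C : nzRingType) (f : B -> C) :
  zmod_morphism f -> monoid_morphism f ->
  exists g : {rmorphism B -> C}, forall x, g x = f x.
Proof.
move=> fB fM.
pose m1 := GRing.isZmodMorphism.Build B C f fB.
pose m2 := GRing.isMonoidMorphism.Build B C f fM.
pose g : {rmorphism B -> C} := HB.pack f m1 m2.
by exists g.
Qed.

(** * Open and closed annuli *)

(* B stands for R[[X,Y]] (eps = true) or R{X,Y} (eps = false), embedded in the
   double power series by iota. *)
Section Disk.
Variables (K : fieldType) (v : discreteValuation K).
Local Notation R := (valRing v).
Local Notation PS := (fps (fps R)).
Variables (eps : bool) (B : comNzRingType) (iota : {rmorphism B -> PS}).
Hypothesis hcomplete : complete_valuation v.
Hypothesis iota_inj : injective iota.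
Hypothesis iotaP : forall F, conv eps F <-> exists f, iota f = F.
Variables (BC : R -> B) (BX BY : B).
Hypothesis iotaC : forall c, iota (BC c) = psC c.
Hypotheses (iotaX : iota BX = psX) (iotaY : iota BY = psY).
Variables (pi : R) (hpi : uniformizer pi).

(** * Completeness and successive approximation in the bidisk ring *)

Local Notation bFil n f := (Fil eps n (iota f)).

Lemma conv_iota f : conv eps (iota f).
Proof. by apply/iotaP; exists f. Qed.

Lemma bFil_eq0 f : (forall n, bFil n f) -> f = 0.
Proof. by move=> /Fil_eq0 h; apply: iota_inj; rewrite rmorph0. Qed.

Lemma BCD a b : BC (a + b) = BC a + BC b.
Proof. by apply: iota_inj; rewrite rmorphD !iotaC rmorphD. Qed.
Lemma BCN a : BC (- a) = - BC a.
Proof. by apply: iota_inj; rewrite rmorphN !iotaC rmorphN. Qed.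
Lemma BCM a b : BC (a * b) = BC a * BC b.
Proof. by apply: iota_inj; rewrite rmorphM !iotaC rmorphM. Qed.
Lemma BC1 : BC 1 = 1.
Proof. by apply: iota_inj; rewrite iotaC !rmorph1. Qed.
Lemma BCn n : BC n%:R = n%:R.
Proof. by apply: iota_inj; rewrite iotaC !rmorph_nat. Qed.
Lemma BCXn a n : BC (a ^+ n) = BC a ^+ n.
Proof. by apply: iota_inj; rewrite rmorphXn !iotaC rmorphXn. Qed.

Lemma disk_cauchy (g : nat -> B) :
  (forall n, bFil n (g n.+1 - g n)) -> exists f, forall n, bFil n (f - g n).
Proof.
move=> hg.
have hkl (p : nat * nat) : exists s, forall n,
    mpow (n - eps * (p.1 + p.2)) (s - cf (iota (g n)) p.1 p.2).
  apply: valRing_cauchy => // n; have := hg n p.1 p.2.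
  by rewrite rmorphB cfB.
have [c hc] := choice hkl.
pose F : PS := Fps (fun l => Fps (fun k => c (k, l))).
have hF n : Fil eps n (F - iota (g n)).
  by move=> k l; rewrite cfB; apply: hc (k, l) n.
have /iotaP[f fF] : conv eps F.
  by apply: conv_approx => n; exists (iota (g n)) => //; apply: conv_iota.
by exists f => n; rewrite rmorphB fF.
Qed.

(** Contraction principle: the iterates of 0 converge. The restriction to [Fil m] admits maps, such
    as the one for square roots, that contract only on a step of the filtration. *)
Lemma disk_fixpoint m (Phi : B -> B) :
  (forall f, bFil m f -> bFil m (Phi f)) ->
  (forall n f g, bFil m f -> bFil m g -> bFil n (f - g) ->
     bFil n.+1 (Phi f - Phi g)) ->
  exists2 f, bFil m f & Phi f = f.
Proof.
move=> hm hPhi; pose g n := iter n Phi 0.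
have gm n : bFil m (g n).
  by elim: n => [|n IH]; [rewrite rmorph0; apply: Fil00 | apply: hm].
have hg n : bFil n (g n.+1 - g n).
  by elim: n => [|n IH]; [apply: Fil0 | exact: hPhi (gm n.+1) (gm n) IH].
have [f hf] := disk_cauchy hg.
have fm : bFil m f by rewrite -[f](subrK (g m)) rmorphD; apply: FilD.
exists f => //; apply/subr0_eq/bFil_eq0 => n.
have -> : Phi f - f = (Phi f - Phi (g n)) - (f - g n.+1) by rewrite /g /=; ring.
rewrite rmorphB; apply: FilB; first exact: FilW (hPhi n _ _ _ _ (hf n)).
exact: FilW (hf n.+1).
Qed.

Lemma disk_inv f : bFil 1 (f - 1) -> exists2 g, bFil 1 (g - 1) & f * g = 1.
Proof.
(* A fixed point satisfies g - (1 - f) g = 1, that is f g = 1. *)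
move=> hf; pose Phi g := 1 + (1 - f) * g.
have h1 : bFil 1 (1 - f) by rewrite -opprB rmorphN; apply: FilN.
have [|n g g' _ _ h|g _ hg] := @disk_fixpoint 0 Phi.
- by move=> g _; apply: Fil0.
- have -> : Phi g - Phi g' = (1 - f) * (g - g') by rewrite /Phi; ring.
  by rewrite rmorphM -add1n; apply: FilM.
exists g; last by have -> : f * g = g - (1 - f) * g; [ring | rewrite -{1}hg addrK].
by rewrite -{1}hg /Phi [1 + _]addrC addrK rmorphM; apply: FilMl.
Qed.

Lemma disk_sqrt (half : R) f : half * 2%:R = 1 -> bFil 1 (f - 1) ->
  exists2 s, bFil 1 (s - 1) & s * s = f.
Proof.
(* With s = 1 + t, the equation s^2 = f becomes 2 t = f - 1 - t^2. The map contracts on [Fil 1],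
   where the factor t + t' gains a step. *)
move=> h2 hf; pose Phi t := BC half * (f - 1 - t * t).
have h2B : BC half * 2%:R = 1 by rewrite -BCn -BCM h2 BC1.
have [|n t t' ht ht' h|t ht htt] := @disk_fixpoint 1 Phi.
- move=> t ht; rewrite /Phi rmorphM; apply: FilMr.
  by rewrite rmorphB; apply: FilB => //; rewrite rmorphM; apply: FilMl.
- have -> : Phi t - Phi t' = - (BC half * ((t + t') * (t - t'))).
    by rewrite /Phi; ring.
  rewrite rmorphN; apply: FilN; rewrite rmorphM; apply: FilMr.
  by rewrite rmorphM -add1n; apply: FilM; rewrite // rmorphD; apply: FilD.
exists (1 + t); first by rewrite [1 + t]addrC addrK.
have -> : (1 + t) * (1 + t) = 1 + 2%:R * t + t * t by ring.
have e2 : 2%:R * t = f - 1 - t * t.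
  rewrite -[in LHS]htt /Phi mulrA [2%:R * _]mulrC h2B mul1r //.
by rewrite e2; ring.
Qed.

(** * Division by pi, X and Y, and substitutions in the bidisk ring *)

Lemma disk_div f : (forall k l, mpow 1 (cf (iota f) k l)) ->
  exists g, f = BC pi * g.
Proof.
move=> hf.
have hkl (p : nat * nat) : exists s, cf (iota f) p.1 p.2 = pi * s.
  exact: (mpow1P hpi (hf _ _)).
have [c hc] := choice hkl.
pose G : PS := Fps (fun l => Fps (fun k => c (k, l))).
have fG : iota f = psC pi * G by apply: cfP => k l; rewrite cfCM (hc (k, l)).
have /iotaP[g gG] := conv_div hpi (conv_iota f) fG.
by exists g; apply: iota_inj; rewrite rmorphM iotaC gG.
Qed.

Lemma disk_shiftX f : exists g, forall k l,
  cf (iota (f - BX * g)) k l = if k is 0 then cf (iota f) 0 l else 0.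
Proof.
have /iotaP[g hg] := conv_shiftX (conv_iota f).
by exists g => k l; rewrite rmorphB rmorphM iotaX hg ps_splitX.
Qed.

Lemma disk_shiftY f : exists g, forall k l,
  cf (iota (f - BY * g)) k l = if l is 0 then cf (iota f) k 0 else 0.
Proof.
have /iotaP[g hg] := conv_shiftY (conv_iota f).
by exists g => k l; rewrite rmorphB rmorphM iotaY hg ps_splitY.
Qed.

Lemma disk_scale (c : R) f : exists g, forall k l,
  cf (iota g) k l = cf (iota f) k l * c ^+ l.
Proof.
pose G : PS := Fps (fun l => Fps (fun k => cf (iota f) k l * c ^+ l)).
have /iotaP[g hg] : conv eps G.
  move=> n; have [N hN] := conv_iota f n; exists N => k l kl.
  exact/mpowMl/hN.
by exists g => k l; rewrite hg.
Qed.

(* Composed with the scaling of Y by u^-1, the substitution is congruent to the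
   identity modulo each next step of the filtration, hence bijective. *)
Lemma disk_subst_exists (P Q : B) (u : R) :
  bFil 1 (P - 1) -> bFil 1 (Q - 1) -> u \is a GRing.unit ->
  exists T : {rmorphism B -> B},
    [/\ forall c, T (BC c) = BC c, T BX = BX * P, T BY = BC u * BY * Q,
        injective T & forall g, exists f, T f = g].
Proof.
move=> hP hQ hu.
have hP' : Fil eps 1 (iota P - 1) by rewrite -(rmorph1 iota) -rmorphB.
have hQ' : Fil eps 1 (iota Q - 1) by rewrite -(rmorph1 iota) -rmorphB.
have hU : ps_ord 1 (psX * iota P).
  by move=> k l; rewrite cfXM; case: k.
have hV : ps_ord 1 (psC u * psY * iota Q).
  by move=> k l; rewrite -mulrA cfCM cfYM; case: l => [|l]; rewrite ?mulr0 // addnS.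
have [T0 [T0C T0X T0Y T0o]] := subst_fps2_exists hU hV.
have T0fil := Fil_subst T0C T0X T0Y T0o.
have T0scale := Fil_subst_scale hP' hQ' T0C T0X T0Y T0o.
(* [T0] preserves convergence: its values on polynomials come from B, and polynomials are dense. *)
have exT f : exists g, iota g = T0 (iota f).
  apply/iotaP/conv_approx => n; have [N hN] := conv_trunc n (conv_iota f).
  exists (T0 (psTrunc N (iota f))); last by rewrite -rmorphB; apply: T0fil.
  apply/iotaP; rewrite (subst_trunc T0C T0X T0Y).
  exists (\sum_(j < N) \sum_(i < N) BC (cf (iota f) i j) * (BX * P) ^+ i *
            (BC u * BY * Q) ^+ j).
  rewrite rmorph_sum; apply: eq_bigr => j _; rewrite rmorph_sum.
  apply: eq_bigr => i _.
  by rewrite !(rmorphM, rmorphXn) /= !iotaC iotaX iotaY.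
have [T' hT'] := choice exT.
have [||T hT] := @rmorphism_exists _ _ T'.
- by move=> f g; apply: iota_inj; rewrite rmorphB !hT' !rmorphB.
- split=> [|f g]; apply: iota_inj; first by rewrite hT' !rmorph1.
  by rewrite rmorphM !hT' !rmorphM.
have iT f : iota (T f) = T0 (iota f) by rewrite hT hT'.
exists T; split.
- by move=> c; apply: iota_inj; rewrite iT iotaC; exact: T0C.
- by apply: iota_inj; rewrite iT (rmorphM iota) iotaX; exact: T0X.
- by apply: iota_inj; rewrite iT !(rmorphM iota) iotaY iotaC; exact: T0Y.
(* If T f = 0, then f(X, uY) lies in the next step of the filtration, and so does f because u is a
   unit. *)
- apply: raddf_inj => f Tf0; apply: bFil_eq0; elim=> [|n IH]; first exact: Fil0.
  have [g hg] := disk_scale u f.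
  have := T0scale n _ _ IH hg; rewrite -iT Tf0 rmorph0 sub0r => /FilN.
  rewrite opprK => h k l.
  have := h k l; rewrite hg => /(@mpowMl _ _ _ _ (u^-1 ^+ l)).
  by rewrite -mulrA -exprMn divrr // expr1n mulr1.
(* [E] scales Y by u^-1, so [T] after [E] is the identity up to the next step. A fixed point f of
   the map below satisfies T (E f) = g. *)
- move=> g; have [E hE] := choice (disk_scale u^-1).
  have [|n f f' _ _ h|f _ hf] := @disk_fixpoint 0 (fun f => f + (g - T (E f))).
  + by move=> f _; apply: Fil0.
  + have -> : f + (g - T (E f)) - (f' + (g - T (E f'))) =
       - (T (E f - E f') - (f - f')) by rewrite rmorphB; ring.
    rewrite rmorphN rmorphB iT; apply/FilN/T0scale => [k l|k l].
      rewrite rmorphB cfB !hE -mulrBl -cfB -rmorphB; apply: mpowMl; exact: h.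
    rewrite !rmorphB !cfB !hE -mulrBl -mulrA -exprMn mulVr // expr1n mulr1 //.
  exists (E f); apply/esym/subr0_eq.
  by rewrite -[LHS](addKr f) hf addNr.
Qed.

(** * The ring of the annulus and its reduction modulo pi *)

Variables (e : nat) (he : (1 <= e)%N) (A : comAlgType R).
Variable phi : {rmorphism B -> A}.
Hypothesis phiC : forall r, phi (BC r) = r%:A.
Hypothesis phi_surj : forall a, exists f, phi f = a.
Hypothesis phi_ker : forall f, phi f = 0 <->
  exists g, f = g * (BX * BY - BC (pi ^+ e)).

Local Notation x := (phi BX).
Local Notation y := (phi BY).
Local Notation p := (phi (BC pi)).

Let cfI f k l := cf (iota f) k l.

Lemma cfI_C c k l : cfI (BC c) k l = if (k == 0) && (l == 0) then c else 0.
Proof. by rewrite /cfI iotaC cfC. Qed.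
Lemma cfI_D f g k l : cfI (f + g) k l = cfI f k l + cfI g k l.
Proof. by rewrite /cfI (rmorphD iota). Qed.
Lemma cfI_N f k l : cfI (- f) k l = - cfI f k l.
Proof. by rewrite /cfI (rmorphN iota). Qed.
Lemma cfI_B f g k l : cfI (f - g) k l = cfI f k l - cfI g k l.
Proof. by rewrite cfI_D cfI_N. Qed.
Lemma cfI_CM c f k l : cfI (BC c * f) k l = c * cfI f k l.
Proof. by rewrite /cfI (rmorphM iota) iotaC cfCM. Qed.
Lemma cfI_XM f k l : cfI (BX * f) k l = if k is k'.+1 then cfI f k' l else 0.
Proof. by rewrite /cfI (rmorphM iota) iotaX cfXM. Qed.
Lemma cfI_YM f k l : cfI (BY * f) k l = if l is l'.+1 then cfI f k l' else 0.
Proof. by rewrite /cfI (rmorphM iota) iotaY cfYM. Qed.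
Lemma cfI_1 k l : cfI 1 k l = if (k == 0) && (l == 0) then 1 else 0.
Proof. by rewrite -BC1 cfI_C. Qed.

Lemma mpow1_pie r : mpow 1 (pi ^+ e * r).
Proof. by apply/mpowMl/mpowW/(mpow_piX hpi e). Qed.

Lemma phi_eq f g : phi f = phi g ->
  exists h, f = g + h * (BX * BY - BC (pi ^+ e)).
Proof.
move=> /eqP; rewrite -subr_eq0 -rmorphB => /eqP/phi_ker[h hh].
by exists h; rewrite -hh addrC subrK.
Qed.

Lemma phi_xy : x * y = p ^+ e.
Proof.
apply/subr0_eq; rewrite -rmorphM -rmorphXn -rmorphB; apply/phi_ker.
by exists 1; rewrite mul1r BCXn.
Qed.

Lemma relM h : h * (BX * BY - BC (pi ^+ e))
  = BX * (BY * h) - BC (pi ^+ e) * h.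
Proof. by ring. Qed.

Lemma BC_pi_regular f : BC pi * f = 0 -> f = 0.
Proof.
move=> h; apply: iota_inj; apply: cfP => k l; rewrite (rmorph0 iota) cf0.
by apply: (pi_regular hpi); rewrite -/(cfI f k l) -cfI_CM h /cfI (rmorph0 iota).
Qed.

(** If pi f = h (X Y - pi^e), the coefficients of X^(k+1) Y^(l+1) show that pi divides h, as e is
    positive; then pi cancels. *)
Lemma phi_pi_regular a : p * a = 0 -> a = 0.
Proof.
have [f <-] := phi_surj a; rewrite -rmorphM => /phi_ker[h hh].
have [|h' hE] := @disk_div h.
  move=> k l; have := congr1 (fun f => cfI f k.+1 l.+1) hh.
  rewrite /= cfI_CM relM cfI_B cfI_XM cfI_YM cfI_CM => h1.
  have -> : cf (iota h) k l = pi * cfI f k.+1 l.+1 + pi ^+ e * cfI h k.+1 l.+1.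
    by rewrite h1 subrK.
  by apply: mpowD (mpow1_pie _); apply/mpowMl/mpow_pi.
apply/phi_ker; exists h'; apply/subr0_eq/BC_pi_regular.
by rewrite mulrBr hh hE; ring.
Qed.

Lemma phi_piX_regular n a : p ^+ n * a = 0 -> a = 0.
Proof.
elim: n => [|n IH]; first by rewrite mul1r.
by rewrite exprS -mulrA => /phi_pi_regular.
Qed.

Lemma phi_x_regular a : x * a = 0 -> a = 0.
Proof.
by move=> h; apply: (@phi_piX_regular e); rewrite -phi_xy mulrAC h mul0r.
Qed.

(** Modulo pi the relation becomes X Y = 0, and there the annihilator of x is generated by y. *)
Lemma phi_x_reduction h c : h * x = p * c -> exists b d, h = b * y + d * p.
Proof.
have [H <-] := phi_surj h; have [G <-] := phi_surj c.
rewrite -!rmorphM => /phi_eq[k hk].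
have [|g hg] := @disk_div (H - BY * k).
  move=> i j; have := congr1 (fun f => cfI f i.+1 j) hk.
  rewrite /= mulrC cfI_XM cfI_D relM cfI_B cfI_XM !cfI_CM => h1.
  rewrite -/(cfI _ i j) cfI_B h1.
  have -> (a b d : R) : a + (b - d) - b = a - d by ring.
  by apply: mpowB (mpow1_pie _); apply/mpowMl/mpow_pi.
exists (phi k), (phi g); rewrite -!rmorphM -rmorphD; congr (phi _).
by rewrite [g * _]mulrC -hg; ring.
Qed.

Lemma phi_y_reduction h c : h * y = p * c -> exists b d, h = b * x + d * p.
Proof.
have [H <-] := phi_surj h; have [G <-] := phi_surj c.
rewrite -!rmorphM => /phi_eq[k hk].
have [|g hg] := @disk_div (H - BX * k).
  move=> i j; have := congr1 (fun f => cfI f i j.+1) hk.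
  rewrite /= mulrC cfI_YM cfI_D relM cfI_B [BX * _]mulrCA cfI_YM !cfI_CM => h1.
  rewrite -/(cfI _ i j) cfI_B h1.
  have -> (a b d : R) : a + (b - d) - b = a - d by ring.
  by apply: mpowB (mpow1_pie _); apply/mpowMl/mpow_pi.
exists (phi k), (phi g); rewrite -!rmorphM -rmorphD; congr (phi _).
by rewrite [g * _]mulrC -hg; ring.
Qed.

(** The relation X Y - pi^e vanishes modulo pi at Y = 0, so membership in (y, p) can be read on any
    representative. *)
Lemma phi_mem_y f : (exists b d, phi f = b * y + d * p) <->
  forall k, mpow 1 (cfI f k 0).
Proof.
split=> [[b [d]]|hf].
  have [b' <-] := phi_surj b; have [d' <-] := phi_surj d.
  rewrite -!rmorphM -rmorphD => /phi_eq[h ->] k.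
  rewrite relM [b' * _]mulrC [d' * _]mulrC [BX * _]mulrCA.
  rewrite cfI_D cfI_B cfI_D !cfI_YM !cfI_CM add0r sub0r.
  by apply: mpowD; [apply/mpowMl/mpow_pi | rewrite mpowN mpow1_pie].
have [g hg] := disk_shiftY f.
have [|d hd] := @disk_div (f - BY * g).
  by move=> k l; rewrite hg; case: l => *; [apply: hf | apply: mpow00].
exists (phi g), (phi d); rewrite -!rmorphM -rmorphD; congr (phi _).
by rewrite [d * _]mulrC -hd; ring.
Qed.

Lemma phi_mem_x f : (exists b d, phi f = b * x + d * p) <->
  forall l, mpow 1 (cfI f 0 l).
Proof.
split=> [[b [d]]|hf].
  have [b' <-] := phi_surj b; have [d' <-] := phi_surj d.
  rewrite -!rmorphM -rmorphD => /phi_eq[h ->] l.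
  rewrite relM [b' * _]mulrC [d' * _]mulrC.
  rewrite cfI_D cfI_B cfI_D !cfI_XM !cfI_CM add0r sub0r.
  by apply: mpowD; [apply/mpowMl/mpow_pi | rewrite mpowN mpow1_pie].
have [g hg] := disk_shiftX f.
have [|d hd] := @disk_div (f - BX * g).
  by move=> k l; rewrite hg; case: k => *; [apply: hf | apply: mpow00].
exists (phi g), (phi d); rewrite -!rmorphM -rmorphD; congr (phi _).
by rewrite [d * _]mulrC -hd; ring.
Qed.

(** Setting Y = 0 embeds the quotient by (y, p) in the power series over the residue field, a
    domain. *)
Lemma phi_y_prime g b c d : ~ (exists b d, g = b * y + d * p) ->
  g * b = c * y + d * p -> exists c d, b = c * y + d * p.
Proof.
have [G <-] := phi_surj g; have [H <-] := phi_surj b => hG hGH.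
have /phi_mem_y h : exists c d, phi (G * H) = c * y + d * p.
  by exists c, d; rewrite rmorphM.
apply/phi_mem_y; apply: (@mpow1_fps_prime _ _ (psRowX (iota G)) (psRowX (iota H))).
  by move=> n; rewrite -psRowXM -(rmorphM iota); apply: h.
by move=> h1; apply/hG/phi_mem_y.
Qed.

Lemma phi_x_prime g b c d : ~ (exists b d, g = b * x + d * p) ->
  g * b = c * x + d * p -> exists c d, b = c * x + d * p.
Proof.
have [G <-] := phi_surj g; have [H <-] := phi_surj b => hG hGH.
have /phi_mem_x h : exists c d, phi (G * H) = c * x + d * p.
  by exists c, d; rewrite rmorphM.
apply/phi_mem_x; apply: (@mpow1_fps_prime _ _ (psRowY (iota G)) (psRowY (iota H))).
  by move=> n; rewrite -psRowYM -(rmorphM iota); apply: h.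
by move=> h1; apply/hG/phi_mem_x.
Qed.

Lemma phi_x_notin_y : ~ (exists b d, x = b * y + d * p).
Proof.
move=> /phi_mem_y/(_ 1%N); rewrite -[BX]mulr1 cfI_XM cfI_1 /=.
by apply/negP/mpow11.
Qed.

Lemma phi_y_notin_x : ~ (exists b d, y = b * x + d * p).
Proof.
move=> /phi_mem_x/(_ 1%N); rewrite -[BY]mulr1 cfI_YM cfI_1 /=.
by apply/negP/mpow11.
Qed.

Lemma bFil_BC n c : mpow n c -> bFil n (BC c).
Proof.
move=> hc k l; rewrite iotaC cfC; case: ifP => [_|_]; last exact: mpow00.
by apply: mpowW hc; rewrite leq_subr.
Qed.

(** Generators of the ideal J, with X and Y present only if [eps] holds; they make it visible that
    sigma preserves J. *)
Lemma bFil1P f : bFil 1 f <-> exists b c d,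
  f = BX * b *+ eps + BY * c *+ eps + BC pi * d.
Proof.
split=> [hf|[b [c [d ->]]]].
  case: (boolP eps) => heps; last first.
    exists 0, 0; have [|d ->] := @disk_div f.
      by move=> k l; have := hf k l; rewrite (negPf heps).
    by exists d; rewrite !add0r.
  have [g hg] := disk_shiftX f.
  have [g' hg'] := disk_shiftY (f - BX * g).
  have [|d hd] := @disk_div (f - BX * g - BY * g').
    move=> k l; rewrite hg' hg; case: l => [|l]; last exact: mpow00.
    case: k => [|k]; last exact: mpow00.
    by have := hf 0 0; rewrite muln0 subn0.
  by exists g, g', d; rewrite -hd !mulr1n; ring.
have hp : bFil 1 (BC pi) by apply: bFil_BC (mpow_pi hpi).
have hX g : bFil 1 (BX * g *+ eps).
  case: (boolP eps) => [heps|_]; last by rewrite mulr0n (rmorph0 iota); apply: Fil00.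
  by case=> [|k] l; rewrite -/(cfI _ _ _) cfI_XM ?mpow00 // mul1n subSS sub0n mpow0.
have hY g : bFil 1 (BY * g *+ eps).
  case: (boolP eps) => [heps|_]; last by rewrite mulr0n (rmorph0 iota); apply: Fil00.
  move=> k [|l]; rewrite -/(cfI _ _ _) cfI_YM ?mpow00 //.
  by rewrite mul1n addnS subSS sub0n mpow0.
rewrite !(rmorphD iota); apply: FilD; first exact: FilD.
by rewrite (rmorphM iota); apply: FilMl.
Qed.

(** Every multiple of X Y - pi^e has its constant coefficient divisible by pi. Hence the constant of
    an element modulo J is well defined in the residue field. *)
Lemma phi_BC_Fil1 c f : bFil 1 f -> phi (BC c + f) = 0 -> mpow 1 c.
Proof.
move=> hf; rewrite -(rmorph0 phi) => /phi_eq[h].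
rewrite add0r => /(congr1 (fun f => cfI f 0 0)).
rewrite relM cfI_D cfI_C cfI_B cfI_XM cfI_CM sub0r /= => /eqP.
rewrite -[_ == _]subr_eq0 opprK -addrA addr_eq0 => /eqP ->.
rewrite mpowN; apply: mpowD (mpow1_pie _).
by have := hf 0 0; rewrite muln0 subn0.
Qed.

(* In the closed case, a unit reduces to a constant because its reductions
   modulo X and modulo Y are invertible polynomials over the residue field. *)
Lemma phi_unit_constant w w' : w * w' = 1 ->
  exists r f, [/\ r \is a GRing.unit, bFil 1 f & w = phi (BC r + f)].
Proof.
have [W0 W0E] := phi_surj w; have [W' W'E] := phi_surj w'.
rewrite -W0E -W'E => ww'.
have [g1 hg1] := disk_shiftX W0.
have [g2 hg2] := disk_shiftY g1.
(* The part of [W0] divisible by X Y is X Y g2. Replacing X Y by pi^e there makes all mixed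
   coefficients divisible by pi. *)
pose W := (W0 - BX * g1) + BX * (g1 - BY * g2) + BC (pi ^+ e) * g2.
have WE : phi W = phi W0.
  apply/subr0_eq; rewrite -rmorphB; apply/phi_ker; exists (- g2).
  by rewrite /W; ring.
have [h hh] : exists h, W * W' = 1 + h * (BX * BY - BC (pi ^+ e)).
  by apply: phi_eq; rewrite rmorphM WE ww' rmorph1.
have W00 : cfI W 0 0 \is a GRing.unit.
  have := congr1 (fun f => cfI f 0 0) hh.
  rewrite relM cfI_D cfI_1 cfI_B cfI_XM cfI_CM /= sub0r {1}/cfI (rmorphM iota) cfM00.
  rewrite unit_mpow1E -!/(cfI _ 0 0) => h00; apply/negP => h1.
  have := mpow11 v; rewrite -(subrK (pi ^+ e * cfI h 0 0) 1) -h00.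
  by rewrite mpowD ?mpow1_pie // mpowMl.
exists (cfI W 0 0), (W - BC (cfI W 0 0)); split=> //; last first.
  by rewrite addrC subrK WE.
rewrite (rmorphB iota) => k l; rewrite iotaC cfB cfC -/(cfI _ _ _).
case: ifP => [/andP[/eqP-> /eqP->]|kl]; first by rewrite subrr mpow00.
rewrite subr0; have [heps|heps] := boolP eps.
  (* Open case: off the constant term, [Fil 1] imposes no condition. *)
  rewrite mul1n; move: kl; case: k l => [|k] [|l] //= _;
    rewrite ?addnS ?addSn subSS sub0n; exact: mpow0.
have ev F : exists N, forall k l, (N <= k + l)%N -> mpow 1 (cfI F k l).
  have [N hN] := conv_iota F 1%N; exists N => i j ij.
  by have := hN i j ij; rewrite (negPf heps).
have [N hN] := ev W; have [N' hN'] := ev W'.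
have hmax n : (maxn N N' <= n)%N -> (N <= n)%N && (N' <= n)%N by rewrite geq_max.
rewrite mul0n subn0.
(* Modulo pi the product is 1 + X Y h, which is 1 at Y = 0 and at X = 0. This settles the pure
   powers of X and of Y; the mixed coefficients vanish by the choice of [W]. *)
have hrel k' l' : mpow 1 (cfI (W * W') k' l')
    = mpow 1 (cfI (1 + BX * (BY * h)) k' l').
  rewrite hh relM addrA cfI_B cfI_CM; apply/idP/idP => h1.
    by rewrite -(subrK (pi ^+ e * cfI h k' l') (cfI _ _ _)); apply: mpowD (mpow1_pie _).
  exact: mpowB (mpow1_pie _).
case: l kl => [|l].
  case: k => [//|k] _.
  apply: (@mpow1_fps_unit _ _ (psRowX (iota W)) (psRowX (iota W'))
    (maxn N N')) => //.
  - by move=> n /hmax/andP[n1 n2]; rewrite hN ?addn0 // hN' ?addn0.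
  - rewrite -psRowXM -(rmorphM iota) -/(cfI (W * W') 0 0) hrel.
    by rewrite cfI_D cfI_1 cfI_XM addr0 mpow11.
  - move=> [//|n] _.
    rewrite -psRowXM -(rmorphM iota) -/(cfI (W * W') n.+1 0) hrel.
    by rewrite cfI_D cfI_1 cfI_XM cfI_YM addr0 mpow00.
case: k => [|k] _.
  apply: (@mpow1_fps_unit _ _ (psRowY (iota W)) (psRowY (iota W'))
    (maxn N N')) => //.
  - by move=> n /hmax/andP[n1 n2]; rewrite hN // hN'.
  - rewrite -psRowYM -(rmorphM iota) -/(cfI (W * W') 0 0) hrel.
    by rewrite cfI_D cfI_1 cfI_XM addr0 mpow11.
  - move=> [//|n] _.
    rewrite -psRowYM -(rmorphM iota) -/(cfI (W * W') 0 n.+1) hrel.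
    by rewrite cfI_D cfI_1 cfI_XM addr0 mpow00.
rewrite /W cfI_D cfI_D cfI_XM cfI_CM {1}/cfI hg1 {1}/cfI hg2 !add0r.
exact: mpow1_pie.
Qed.


(** * The automorphism that switches the branches *)

Variables (tau : {rmorphism R -> R}) (sigma : {rmorphism A -> A}).
Hypotheses (tauK : involutive tau) (sigmaK : involutive sigma).
Hypothesis sigmaC : forall r, sigma r%:A = (tau r)%:A.
Variables (half zeta : R).
Hypothesis half2 : half * 2%:R = 1.
Hypothesis zeta1 : zeta = 1 \/ zeta = -1.
Hypothesis tau_pi : tau pi = zeta * pi.
Hypothesis switchX : forall a,
  reduction_ideal pi x (sigma a) <-> reduction_ideal pi y a.
Hypothesis switchY : forall a,
  reduction_ideal pi y (sigma a) <-> reduction_ideal pi x a.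
Hypothesis tau_res : zeta = -1 -> odd e -> forall r, mpow 1 (tau r - r).

Lemma sigma_BC r : sigma (phi (BC r)) = phi (BC (tau r)).
Proof. by rewrite !phiC sigmaC. Qed.

Lemma sigma_xy : sigma x * sigma y = phi (BC (zeta ^+ e)) * (x * y).
Proof.
have pe : p ^+ e = phi (BC (pi ^+ e)) by rewrite BCXn rmorphXn.
by rewrite -rmorphM phi_xy pe sigma_BC -rmorphM -BCM rmorphXn tau_pi exprMn.
Qed.

Lemma sigma_x_dvd : exists w, sigma x = w * y.
Proof.
apply: (dvd_of_dvd_mul phi_xy phi_pi_regular phi_x_reduction (g := sigma y)).
  move=> b c d; apply: phi_y_prime => -[b' [c' h]]; apply: phi_y_notin_x.
  have /switchY[b1 [c1 h1]] : reduction_ideal pi y (sigma y).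
    by exists b', c'; rewrite -phiC.
  by exists b1, c1; rewrite phiC.
by exists (phi (BC (zeta ^+ e)) * x); rewrite mulrC sigma_xy; ring.
Qed.

Lemma sigma_y_dvd : exists w, sigma y = w * x.
Proof.
have yx : y * x = p ^+ e by rewrite mulrC phi_xy.
apply: (dvd_of_dvd_mul yx phi_pi_regular phi_y_reduction (g := sigma x)).
  move=> b c d; apply: phi_x_prime => -[b' [c' h]]; apply: phi_x_notin_y.
  have /switchX[b1 [c1 h1]] : reduction_ideal pi x (sigma x).
    by exists b', c'; rewrite -phiC.
  by exists b1, c1; rewrite phiC.
by exists (phi (BC (zeta ^+ e)) * y); rewrite sigma_xy; ring.
Qed.

Lemma sigma_x_unit : exists w w', [/\ sigma x = w * y, sigma y = w' * x,
  w * sigma w' = 1 & w = phi (BC (zeta ^+ e)) * sigma w].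
Proof.
have [w hw] := sigma_x_dvd; have [w' hw'] := sigma_y_dvd.
(* Applying sigma twice to x gives sigma(w) w' x = x, and x is regular. *)
have ww' : sigma w * w' = 1.
  apply/subr0_eq/phi_x_regular.
  by rewrite mulrBr mulr1 mulrC -mulrA -hw' -rmorphM -hw sigmaK subrr.
exists w, w'; split=> //.
  by rewrite -[w]sigmaK -rmorphM ww' rmorph1.
(* Comparison of w w' x y = sigma(x) sigma(y) with [sigma_xy], then cancellation of x y = p^e. *)
have hz : w * w' = phi (BC (zeta ^+ e)).
  have h : x * (y * (w * w' - phi (BC (zeta ^+ e)))) = 0.
    have -> : x * (y * (w * w' - phi (BC (zeta ^+ e))))
      = (w * y) * (w' * x) - phi (BC (zeta ^+ e)) * (x * y) by ring.
    by rewrite -hw -hw' sigma_xy subrr.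
  have {}h : p ^+ e * (w * w' - phi (BC (zeta ^+ e))) = 0 by rewrite -phi_xy -mulrA.
  exact/subr0_eq/(phi_piX_regular h).
by rewrite -hz -mulrA [w' * _]mulrC ww' mulr1.
Qed.

(** Since sigma exchanges x and y up to factors and multiplies p by zeta, it preserves J. *)
Lemma sigma_Fil1 w w' f : sigma x = w * y -> sigma y = w' * x -> bFil 1 f ->
  exists2 g, bFil 1 g & sigma (phi f) = phi g.
Proof.
move=> hw hw' /bFil1P[b [c [d ->]]].
have [b' hb] := phi_surj (sigma (phi b) * w).
have [c' hc] := phi_surj (sigma (phi c) * w').
have [d' hd] := phi_surj (sigma (phi d)).
exists (BX * c' *+ eps + BY * b' *+ eps + BC pi * (BC zeta * d')).
  by apply/bFil1P; exists c', b', (BC zeta * d').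
rewrite !(rmorphD, rmorphM, rmorphMn) hb hc hd hw hw' sigma_BC tau_pi BCM !rmorphM.
by case: (eps); rewrite ?mulr1n ?mulr0n; ring.
Qed.

Lemma sigma_unit_constant w w0 w' r f : sigma x = w * y -> sigma y = w' * x ->
  bFil 1 f -> w0 = phi (BC r + f) ->
  exists2 g, bFil 1 g & sigma w0 = phi (BC (tau r) + g).
Proof.
move=> hw hw' hf ->; have [g hg gE] := sigma_Fil1 hw hw' hf.
by exists g; rewrite // !rmorphD sigma_BC gE.
Qed.

Lemma two_unit : (2%:R : R) \is a GRing.unit.
Proof. by apply/unitrPr; exists half; rewrite mulrC. Qed.

(** If zeta^e = -1, then w = - sigma(w), and its constant satisfies r + tau(r) = 0 in the residue
    field. The trivial action of tau there, available since e is then odd, turns this into 2 r =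
    0. *)
Lemma zeta_expe w w' : sigma x = w * y -> sigma y = w' * x ->
  w * sigma w' = 1 -> w = phi (BC (zeta ^+ e)) * sigma w -> zeta ^+ e = 1.
Proof.
move=> hw hw' ww' wz; case: zeta1 => hz; first by rewrite hz expr1n.
rewrite hz -signr_odd; case: (boolP (odd e)) => //= oe; exfalso.
have [r [f [hr hf wE]]] := phi_unit_constant ww'.
have [g hg swE] := sigma_unit_constant hw hw' hf wE.
move: wz; rewrite hz -signr_odd oe expr1 swE wE -rmorphM.
move=> h; have : phi (BC (r + tau r) + (f + g)) = 0.
  apply/eqP; rewrite -[_ == _]subr_eq0 subr0; apply/eqP.
  have -> : BC (r + tau r) + (f + g) = BC r + f + (BC (tau r) + g).
    by rewrite BCD; ring.
  by rewrite rmorphD h BCN BC1 mulN1r rmorphN addNr.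
move=> /phi_BC_Fil1-/(_ _)h1.
have {}h1 : mpow 1 (r + tau r) by apply: h1; rewrite (rmorphD iota); apply: FilD.
have := mpowB h1 (tau_res hz oe r).
have -> : r + tau r - (tau r - r) = 2%:R * r by ring.
by apply/negP; rewrite -unit_mpow1E unitrM two_unit.
Qed.

Lemma switch_normal_form : zeta ^+ e = 1 /\
  exists (u : R) (psi : {rmorphism B -> A}),
    [/\ u \is a GRing.unit /\ tau u = u,
        sigma (psi BX) = psi BY /\ sigma (psi BY) = psi BX,
        forall r, psi (BC r) = r%:A,
        forall a, exists f, psi f = a
      & forall f, psi f = 0 <-> exists g, f = g * (BX * BY - BC (u * pi ^+ e))].
Proof.
have [w [w' [hw hw' ww' wz]]] := sigma_x_unit.
have ze := zeta_expe hw hw' ww' wz; split=> //.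
have sw : sigma w = w by rewrite [RHS]wz ze BC1 rmorph1 mul1r.
have [r [f [hr hf wE]]] := phi_unit_constant ww'.
have [g hg swE] := sigma_unit_constant hw hw' hf wE.
(* Since w is invariant, its constants r and tau(r) agree in the residue field. *)
have hrt : mpow 1 (r - tau r).
  apply: (@phi_BC_Fil1 _ (f - g)); first by rewrite (rmorphB iota); apply: FilB.
  have -> : BC (r - tau r) + (f - g) = (BC r + f) - (BC (tau r) + g).
    by rewrite BCD BCN; ring.
  by rewrite rmorphB -wE -swE sw subrr.
pose u := half * (r + tau r).
have tau_half : tau half = half.
  apply: (mulIr two_unit); rewrite half2 -(rmorph_nat tau 2) -rmorphM half2.
  exact: rmorph1.
have tau_u : tau u = u by rewrite rmorphM rmorphD tau_half tauK addrC.
have hru : mpow 1 (r - u).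
  have -> : r - u = half * (r - tau r).
    have -> : r - u = half * 2%:R * r - u by rewrite half2 mul1r.
    by rewrite /u; ring.
  exact: mpowMr.
clearbody u.
have hu : u \is a GRing.unit.
  rewrite unit_mpow1E; apply/negP => h; move: hr; rewrite unit_mpow1E => /negP; apply.
  by rewrite -(subrK u r) mpowD.
have BCu : BC u * BC u^-1 = 1 by rewrite -BCM divrr // BC1.
(* [S] lifts the square root s of w / u; [S'] will be its inverse, and the substitution [T] sends X
   to X S' and Y to u Y S. *)
have [|S hS SS] := @disk_sqrt half (BC u^-1 * (BC r + f)) half2.
  have -> : BC u^-1 * (BC r + f) - 1 = BC (u^-1 * (r - u)) + BC u^-1 * f.
    by rewrite -BCu [BC u * _]mulrC BCM BCD BCN; ring.
  rewrite (rmorphD iota); apply: FilD; first exact/bFil_BC/mpowMr.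
  by rewrite (rmorphM iota); apply: FilMr.
have [S' hS' SS'] := disk_inv hS.
have ss : phi S * phi S = phi (BC u^-1) * w by rewrite -rmorphM SS rmorphM wE.
have sss : sigma (phi S * phi S) = phi S * phi S.
  rewrite ss rmorphM sw sigma_BC; congr (phi (BC _) * _).
  apply: (mulrI hu); rewrite divrr // -{1}tau_u -rmorphM divrr //; exact: rmorph1.
(* Both s and sigma(s) lie in 1 + J, so their sum is 2 V with V in 1 + J, a unit. As their squares
   agree, so do they. *)
have sigma_s : sigma (phi S) = phi S.
  have [G hG GE] := sigma_Fil1 hw hw' hS.
  have sE : sigma (phi S) = 1 + phi G by rewrite -GE !rmorphB !rmorph1 addrC subrK.
  have BCh : BC half * 2%:R = 1 by rewrite -BCn -BCM half2 BC1.
  pose V := 1 + BC half * ((S - 1) + G).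
  have [|V' _ VV'] := @disk_inv V.
    rewrite /V addrC addKr (rmorphM iota); apply: FilMr.
    by rewrite (rmorphD iota); apply: FilD.
  have sV : phi S + sigma (phi S) = phi (2%:R * V).
    rewrite sE -[1](rmorph1 phi) -!rmorphD; congr (phi _).
    by rewrite /V mulrDr mulrA [2%:R * BC _]mulrC BCh; ring.
  have h0 : (phi S - sigma (phi S)) * phi (2%:R * V) = 0.
    have -> : (phi S - sigma (phi S)) * phi (2%:R * V)
       = phi S * phi S - sigma (phi S * phi S) by rewrite -sV rmorphM; ring.
    by rewrite sss subrr.
  have := congr1 ( *%R^~ (phi (BC half * V'))) h0.
  rewrite mul0r -mulrA -rmorphM.
  have -> : 2%:R * V * (BC half * V') = (BC half * 2%:R) * (V * V') by ring.
  by rewrite BCh VV' mulr1 rmorph1 mulr1 => /subr0_eq.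
have ss' : phi S * phi S' = 1 by rewrite -rmorphM SS' rmorph1.
have sigma_s' : sigma (phi S') = phi S'.
  have h : phi S * sigma (phi S') = 1.
    by rewrite -{1}sigma_s -rmorphM ss' rmorph1.
  by rewrite -[LHS]mul1r -ss' mulrAC h mul1r.
have [T [TC TX TY T_inj T_surj]] := disk_subst_exists hS' hS hu.
(* [T] carries the ideal of the new relation onto that of the old one, so phi composed with [T] has
   the kernel wanted for [psi]. *)
have TXY : T (BX * BY - BC (u * pi ^+ e)) = BC u * (BX * BY - BC (pi ^+ e)).
  rewrite rmorphB rmorphM TX TY TC BCM.
  have -> : BX * S' * (BC u * BY * S) = BC u * (BX * BY) * (S * S') by ring.
  by rewrite SS'; ring.
(* From w = u s^2 follows sigma(x / s) = w y / s = u s y. *)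
have psiY : phi (T BY) = sigma (phi (T BX)).
  rewrite TX TY !rmorphM sigma_s' hw.
  have -> : w = phi (BC u) * (phi S * phi S).
    by rewrite ss mulrA -rmorphM BCu rmorph1 mul1r.
  have -> : phi (BC u) * (phi S * phi S) * y * phi S'
    = phi (BC u) * y * phi S * (phi S * phi S') by ring.
  by rewrite ss' mulr1.
exists u, (phi \o T); split=> //=.
- by rewrite psiY sigmaK.
- by move=> s; rewrite TC phiC.
- by move=> a; have [h <-] := phi_surj a; have [h' <-] := T_surj h; exists h'.
- move=> h; split.
    move=> /phi_ker[k hk]; have [k' k'E] := T_surj (k * BC u^-1).
    exists k'; apply: T_inj; rewrite rmorphM k'E TXY hk.
    have -> : k * BC u^-1 * (BC u * (BX * BY - BC (pi ^+ e)))
      = k * (BX * BY - BC (pi ^+ e)) * (BC u * BC u^-1) by ring.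
    by rewrite BCu mulr1.
  move=> [k ->]; apply/phi_ker; exists (T k * BC u).
  by rewrite rmorphM TXY mulrA.
Qed.

End Disk.

(** * Semi-open annuli *)

Section GeometricSeries.
Variable S : comNzRingType.
Implicit Types f g h : fps S.

Lemma fpsXnM_low i h m : (m < i)%N -> fpsf (fpsX S ^+ i * h) m = 0.
Proof.
elim: i h m => [//|i IH] h m mi; rewrite exprSr -mulrA.
have -> : fpsf (fpsX S ^+ i * (fpsX S * h)) m
  = \sum_(j < m.+1) fpsf (fpsX S ^+ i) j * fpsf (fpsX S * h) (m - j)%N by [].
rewrite big1 // => j _; have [ji|ij] := ltnP j i.
  by rewrite -[fpsX S ^+ i]mulr1 IH ?mul0r.
have -> : (m - j = 0)%N by lia.
by rewrite [fpsf (_ * _) 0%N]big_ord1 /= mul0r mulr0.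
Qed.

(** The coefficient of degree n of the geometric series involves only the powers up to n. It will
    serve with S = R{X} and Y as the variable. *)
Lemma fps_geometric b : exists g, (1 - fpsX S * b) * g = 1.
Proof.
pose G n : fps S := \sum_(i < n.+1) (fpsX S * b) ^+ i.
exists (Fps (fun n => fpsf (G n) n)); apply: fpsP => n.
have low m i : (m < i)%N -> fpsf ((fpsX S * b) ^+ i) m = 0.
  by move=> mi; rewrite exprMn fpsXnM_low.
have GE m : (m <= n)%N -> fpsf (G m) m = fpsf (G n) m.
  move=> mn; rewrite !fpsf_sum.
  rewrite (big_ord_widen _ (fun i => fpsf ((fpsX S * b) ^+ i) m)
    (_ : m.+1 <= n.+1)%N) //.
  rewrite big_mkcond /=; apply: eq_bigr => i _; case: ifP => // /negbT.
  by rewrite -leqNgt => /low ->.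
transitivity (fpsf ((1 - fpsX S * b) * G n) n).
  apply: eq_bigr => i _; congr (_ * _) => /=.
  by rewrite GE ?leq_subr.
have -> : (1 - fpsX S * b) * G n = 1 - (fpsX S * b) ^+ n.+1.
  by rewrite /G -[X in _ = X - _](expr1n _ n.+1) subrXX; congr (_ * _);
     apply: eq_bigr => i _; rewrite expr1n mul1r.
have -> : fpsf (1 - (fpsX S * b) ^+ n.+1) n
  = fpsf 1 n - fpsf ((fpsX S * b) ^+ n.+1) n by [].
by rewrite low // subr0.
Qed.

Lemma fpsf0M f g : fpsf (f * g) 0%N = fpsf f 0%N * fpsf g 0%N.
Proof. exact: big_ord1. Qed.

Lemma fpsf_CM c f n : fpsf (fpsC c * f) n = c * fpsf f n.
Proof.
rewrite [LHS]big_ord_recl subn0 big1 ?addr0 // => i _.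
by rewrite /= mul0r.
Qed.

Lemma fpsf_XM f n :
  fpsf (fpsX S * f) n = if n is n'.+1 then fpsf f n' else 0.
Proof.
rewrite [LHS]big_ord_recl /= mul0r add0r; case: n => [|n]; first by rewrite big_ord0.
rewrite big_ord_recl big1 => [|i _]; last by rewrite /= mul0r.
by rewrite /= mul1r addr0 subn1.
Qed.

End GeometricSeries.

(** * The three kinds of annuli *)

Section Instances.
Variables (K : fieldType) (v : discreteValuation K).
Local Notation R := (valRing v).

Lemma residue_eq_mpow1 (a b : R) : residue a = residue b -> mpow 1 (a - b).
Proof.
move=> /eqP; rewrite /residue -Quotient.idealrBE => h; exact: h.
Qed.

Lemma mpow1_two : 2%N \notin [pchar residueField v] -> ~~ mpow 1 (2%:R : R).
Proof.
apply: contra => h; rewrite inE /=; apply/eqP.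
have -> : 2%:R = residue (2%:R : R) :> residueField v.
  by rewrite /residue rmorph_nat.
rewrite -[0](rmorph0 \pi_(residueField v)%qT).
apply/eqP; rewrite -Quotient.idealrBE subr0; exact: h.
Qed.

Lemma isomR_rmorphism (tau : isometricAut v) :
  exists t : {rmorphism R -> R}, forall r, t r = isomR tau r.
Proof.
apply: rmorphism_exists => [a b|]; first by apply: val_inj; rewrite /= rmorphB.
by split=> [|a b]; apply: val_inj; rewrite /= ?rmorph1 ?rmorphM.
Qed.

Lemma conv_open (F : fps (fps R)) : conv true F <-> exists f, idfun f = F.
Proof.
split=> _; first by exists F.
by move=> n; exists n => k l kl; rewrite mul1n (eqP kl) mpow0.
Qed.

Lemma conv_closed (F : fps (fps R)) :
  conv false F <-> exists f : cvps2 v, cvps2f f = F.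
Proof.
split=> [hF|[f <-] n]; last first.
  have /in_cvps2P/(_ n%:Z)[N hN] := cvps2P f; exists N => k l kl.
  by rewrite mul0n subn0; apply: hN.
have hF2 : F \in in_cvps2 (v := v).
  apply/in_cvps2P => n; have [N hN] := hF `|n|%N; exists N => i j ij.
  have := hN i j ij; rewrite mul0n subn0 => /orP[h|h]; rewrite /val_ge.
    by rewrite h.
  by apply/orP; right; apply: le_trans h; lia.
by exists (Cvps2 hF2).
Qed.

(** Reduction modulo Y, with values in R{X} seen inside R[[X]]. That these coefficients tend to 0 is
    what will obstruct a switch. *)
Lemma semiopen_modY : exists rho : {rmorphism bidiskRing v SemiOpen -> fps R},
  [/\ rho (bidiskX v SemiOpen) = fpsX R, rho (bidiskY v SemiOpen) = 0,
      forall c, rho (bidiskC SemiOpen c) = fpsC c & forall F, tends0 (rho F)].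
Proof.
pose f (F : fps (cvps v)) : fps R := cvpsf (fpsf F 0%N).
have [||rho rhoE] := @rmorphism_exists (fps (cvps v)) (fps R) f.
- by move=> F G.
- split=> [//|F G]; rewrite /f fpsf0M; exact: (rmorphM (val : cvps v -> fps R)).
exists rho; split=> [|||F].
- exact: rhoE.
- exact: rhoE.
- by move=> c; apply: rhoE.
- by rewrite rhoE; apply/in_cvpsP/cvpsP.
Qed.

Variables (pi : R) (hpi : uniformizer pi).

Lemma semiopen_not_switch (c : R) (A : comAlgType R)
    (phi : annulusIso SemiOpen c A) (sigma : {rmorphism A -> A})
    (tau : R -> R) (zeta : R) :
  mpow 1 c -> involutive sigma -> (forall r, sigma r%:A = (tau r)%:A) ->
  tau pi = zeta * pi ->
  ~ (forall a, reduction_ideal pi (coordY phi) (sigma a) <->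
             reduction_ideal pi (coordX phi) a).
Proof.
move=> hc sigmaK sigmaC tau_pi sw.
have [b [d sx]] : reduction_ideal pi (coordY phi) (sigma (coordX phi)).
  by apply/sw; exists 1, 0; rewrite mul1r mul0r addr0.
have [b' bE] := aiso_surj phi b.
have [g hg] := fps_geometric b'.
have hs : (1 - b * coordY phi) * phi g = 1.
  rewrite -bE /coordY -(rmorph1 phi) [phi b' * _]mulrC -rmorphM -rmorphB -rmorphM.
  by rewrite hg.
(* As sigma(x) = b y + d pi, the inverse of 1 - b y inverts 1 - sigma(x) modulo pi. *)
have e1 : (1 - sigma (coordX phi)) * phi g = 1 - d * pi%:A * phi g.
  by rewrite -[X in _ = X - _]hs sx; ring.
(* Applying sigma once more makes 1 - x invertible modulo pi, with inverse represented by [S]. *)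
have := congr1 sigma e1; rewrite rmorphM rmorphB rmorph1 sigmaK.
rewrite rmorphB rmorph1 !rmorphM sigmaC tau_pi.
have [S hS] := aiso_surj phi (sigma (phi g)).
have [D hD] := aiso_surj phi (sigma d).
rewrite -hS -hD -!(aisoC phi) => e2.
have /aiso_ker[G hG] : phi ((1 - bidiskX v SemiOpen) * S
     - (1 - D * bidiskC SemiOpen (zeta * pi) * S)) = 0.
  rewrite !(rmorphB phi, rmorphM phi, rmorph1 phi); apply/eqP.
  by rewrite subr_eq0 -e2.
have [rho [rhoX rhoY rhoC rho0]] := semiopen_modY.
have {hG} := congr1 rho hG.
rewrite !(rmorphM rho, rmorphB rho, rmorph1 rho) rhoX rhoY !rhoC mulr0 sub0r => h0.
have {}h0 : (1 - fpsX R) * rho S - 1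
   = - (fpsC (zeta * pi) * (rho D * rho S) + fpsC c * rho G).
  have -> : (1 - fpsX R) * rho S - 1 =
     (1 - fpsX R) * rho S - (1 - rho D * fpsC (zeta * pi) * rho S)
       - rho D * fpsC (zeta * pi) * rho S by ring.
  by rewrite h0; ring.
(* At Y = 0 and modulo pi, [S] is the inverse 1 + X + X^2 + ... of 1 - X, whose coefficients do not
   tend to 0. *)
have S1 n : mpow 1 (fpsf (rho S) n - 1).
  have hn m : mpow 1 (fpsf ((1 - fpsX R) * rho S - 1) m).
    rewrite h0 -[fpsf _ m]/(- (fpsf (fpsC (zeta * pi) * (rho D * rho S)) m
       + fpsf (fpsC c * rho G) m)) !fpsf_CM mpowN.
    by apply: mpowD; apply: mpowMl => //; apply/mpowMr/mpow_pi.
  have {}hn m : mpow 1 (fpsf (rho S) m - fpsf (fpsX R * rho S) m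
       - fpsf (1 : fps R) m).
    by have := hn m; rewrite mulrBl mul1r.
  elim: n => [|n IH]; first by have := hn 0%N; rewrite fpsf_XM subr0.
  have := mpowD (hn n.+1) IH; rewrite fpsf_XM [fpsf 1 _]/= subr0.
  by rewrite addrA subrK.
have [N hN] := rho0 S 1.
have /negP[] := mpow11 v.
rewrite -(subKr (fpsf (rho S) N) 1).
by apply: mpowB => //; [apply: hN].
Qed.

End Instances.

Theorem proposition6p8 (K : fieldType) (v : discreteValuation K)
    (hcomplete : complete_valuation v)
    (hchar : 2%N \notin [pchar residueField v])
    (pi : valRing v) (hpi : uniformizer pi)
    (e : nat) (he : (1 <= e)%N)
    (t : annulus_kind) (A : comAlgType (valRing v))
    (phi : annulusIso t (pi ^+ e) A)
    (sigma : annulusAut A) (hsigma : aut_order2 sigma)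
    (zeta : valRing v) (hzeta : zeta = 1 \/ zeta = -1)
    (hsigmapi : isomR (aut_base sigma) pi = zeta * pi)
    (hswitch : switches_branches pi phi sigma)
    (hres : zeta = -1 -> odd e -> acts_trivially_on_residue sigma) :
  (t = Open \/ t = Closed) /\
  zeta ^+ e = 1 /\
  exists (u : valRing v) (X Y : A),
    [/\ u \is a GRing.unit /\ isomR (aut_base sigma) u = u,
        sigma X = Y /\ sigma Y = X,
        t = Open ->
          exists psi : annulusIso Open (u * pi ^+ e) A,
            coordX psi = X /\ coordY psi = Y
      & t = Closed ->
          exists psi : annulusIso Closed (u * pi ^+ e) A,
            coordX psi = X /\ coordY psi = Y].
Proof.
case: hsigma => baseK sigmaK _.
have [tau tauE] := isomR_rmorphism (aut_base sigma).
have tauK : involutive tau.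
  by move=> r; apply: val_inj; rewrite !tauE /= baseK.
have sigmaC r : sigma r%:A = (tau r)%:A by rewrite tauE aut_compat.
have tau_pi : tau pi = zeta * pi by rewrite tauE.
have half2 : (2%:R : valRing v)^-1 * 2%:R = 1.
  by rewrite mulVr // unit_mpow1E mpow1_two.
have tau_res : zeta = -1 -> odd e -> forall r, mpow 1 (tau r - r).
  by move=> z oe r; apply: residue_eq_mpow1; rewrite tauE; apply: hres.
case: hswitch => switchX switchY.
case: t phi switchX switchY => phi switchX switchY.
(* R[[X,Y]] is the whole ring of double series, so [iota] is the identity here; in the closed case
   it is the inclusion of R{X,Y}. *)
- have [|||ze [u [psi [hu hXY psiC psi_surj psi_ker]]]] :=
    switch_normal_form (eps := true) (iota := idfun) (BC := bidiskC Open)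
      (BX := bidiskX v Open) (BY := bidiskY v Open) hcomplete
      (fun _ _ h => h) (@conv_open K v) _ _ _ hpi he (aisoC phi)
      (aiso_surj phi) (aiso_ker phi) tauK sigmaK sigmaC half2 hzeta tau_pi
      switchX switchY tau_res; try by [].
  split; first by left.
  split=> //; exists u, (psi (bidiskX v Open)), (psi (bidiskY v Open)).
  split=> //; first by rewrite -tauE.
  by move=> _; exists (AnnulusIso psiC psi_surj psi_ker).
- case: (semiopen_not_switch hpi _ sigmaK sigmaC tau_pi switchY).
  by apply: mpowW (mpow_piX hpi e).
- have [|||ze [u [psi [hu hXY psiC psi_surj psi_ker]]]] :=
    switch_normal_form (eps := false)
      (iota := (val : cvps2 v -> fps (fps (valRing v)))) (BC := bidiskC Closed)
      (BX := bidiskX v Closed) (BY := bidiskY v Closed) hcomplete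
      val_inj (@conv_closed K v) _ _ _ hpi he (aisoC phi)
      (aiso_surj phi) (aiso_ker phi) tauK sigmaK sigmaC half2 hzeta tau_pi
      switchX switchY tau_res; try by [].
  split; first by right.
  split=> //; exists u, (psi (bidiskX v Closed)), (psi (bidiskY v Closed)).
  split=> //; first by rewrite -tauE.
  by move=> _; exists (AnnulusIso psiC psi_surj psi_ker).
Qed.
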